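(* Let $C$ be a $\circ$-coalgebra over $\mathbb{C}$. The following properties are equivalent. (1) The coalgebra $C$ is compact. (2) The coalgebra $C$, viewed as a right $C$-comodule via $\Delta$, admits a unitary inner product. (3) The coalgebra $C$ admits a Fourier form that is positive definite and hermitian. (4) The coalgebra $C$ admits a Fourier product that is positive definite and hermitian. (5) The coalgebra $C$ can be decomposed as $C=\bigoplus_{\rho\in\widehat{C}} C_\rho$ (for some index set $\widehat{C}$), where each $C_\rho\subset C$ is a simple $\circ$-subcoalgebra and, moreover, each $C_\rho$ admits a basis $\{t^\rho_{ij}: 1\le i,j\le n_\rho\}$ such that for all $1\le i,j\le n_\rho$, $\Delta(t^\rho_{ij})=\sum_k t^\rho_{ik}\otimes t^\rho_{kj}$ and $(t^\rho_{ij})^\circ=t^\rho_{ji}$.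
   Context: Everything is over $\mathbb{C}$. Sweedler notation: $\Delta(c)=\sum c_1\otimes c_2$ for a coalgebra $(C,\Delta,\varepsilon)$, and $\chi(v)=\sum v_0\otimes v_1\in V\otimes C$ for a right $C$-comodule $(V,\chi)$. A $\circ$-structure on $C$ is a conjugate linear involution $c\mapsto c^\circ$ of $C$ with $\Delta(c^\circ)=\sum c_2^\circ\otimes c_1^\circ$; then $(C,\circ)$ is a $\circ$-coalgebra. A $\circ$-subcoalgebra is a subcoalgebra $D$ with $D^\circ=D$. A unitary inner product on a right $C$-comodule $V$ is an inner product (positive definite hermitian form, linear in the first and conjugate linear in the second variable; no completeness required) such that $\sum\langle u_0,v\rangle u_1=\sum\langle u,v_0\rangle v_1^\circ$ for all $u,v\in V$. The $\circ$-coalgebra $C$ is compact if every right $C$-comodule admits a unitary inner product. A Fourier form on $C$ is a bilinear map $\omega:C\times C\to\mathbb{C}$ with $\sum\omega(c,d_1)d_2=\sum c_1\omega(c_2,d)$ for all $c,d\in C$; it is positive definite if $\omega(c^\circ,c)>0$ for all $c\ne0$, and hermitian if $\omega(c^\circ,d^\circ)=\overline{\omega(d,c)}$ for all $c,d$. A Fourier product on $C$ is a bilinear map $\star:C\times C\to C$ with $\Delta(c\star d)=\sum (c\star d_1)\otimes d_2=\sum c_1\otimes(c_2\star d)$ for all $c,d\in C$; it is positive definite if $\varepsilon(c^\circ\star c)>0$ for all $c\ne 0$, and hermitian if $c^\circ\star d^\circ=(d\star c)^\circ$ for all $c,d$. *)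

(* Defs.v *)
From HB Require Import structures.
From mathcomp Require Import all_boot all_order all_algebra.
From mathcomp Require Import all_classical all_reals.
From mathcomp Require Import sesquilinear complex.

Set Implicit Arguments.
Unset Strict Implicit.
Unset Printing Implicit Defensive.

Import Order.TTheory GRing.Theory Num.Theory.

Local Open Scope classical_set_scope.
Local Open Scope quotient_scope.
Local Open Scope ring_scope.

(* The tensor product of two modules over a commutative ring: formal finite   *)
(* sums of pairs modulo the congruence generated by the bilinearity relations.*)
(* A scalar can be absorbed in a factor, so no coefficients are needed.       *)
Fact tensor_key : unit. Proof. exact: tt. Qed.

Section Tensor.
Variables (K : comNzRingType) (V W : lmodType K).

Inductive tensor_rel : seq (V * W) -> seq (V * W) -> Prop :=
| TRefl s : tensor_rel s s
| TSym s t : tensor_rel s t -> tensor_rel t s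
| TTrans s t u : tensor_rel s t -> tensor_rel t u -> tensor_rel s u
| TCat s s' t t' :
    tensor_rel s s' -> tensor_rel t t' -> tensor_rel (s ++ t) (s' ++ t')
| TCatC s t : tensor_rel (s ++ t) (t ++ s)
| TZero w : tensor_rel [:: (0, w)] [::]
| TAddl v v' w : tensor_rel [:: (v + v', w)] [:: (v, w); (v', w)]
| TAddr v w w' : tensor_rel [:: (v, w + w')] [:: (v, w); (v, w')]
| TScale a v w : tensor_rel [:: (a *: v, w)] [:: (v, a *: w)].

Definition tensor_relb (s t : seq (V * W)) : bool := `[< tensor_rel s t >].

Lemma tensor_relb_equiv : equiv_class_of tensor_relb.
Proof.
split=> [s|s t|t s u]; first exact/asboolP/TRefl.
- by apply/asboolP/asboolP; apply: TSym.
- by move=> /asboolP st /asboolP tu; apply/asboolP; apply: TTrans st tu.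
Qed.

Canonical tensor_relb_equivRel := EquivRelPack tensor_relb_equiv.

Definition tensor : Type := {eq_quot tensor_relb}.
HB.instance Definition _ := EqQuotient.on tensor.
HB.instance Definition _ := Choice.on tensor.

Lemma tensor_eqP (s t : seq (V * W)) :
  \pi_tensor s = \pi_tensor t <-> tensor_rel s t.
Proof.
by split=> [/eqP|/asboolP st]; [rewrite eqmodE => /asboolP | apply/eqP; rewrite eqmodE].
Qed.

Lemma tensor_repr (s : seq (V * W)) : tensor_rel (repr (\pi_tensor s)) s.
Proof. by apply/tensor_eqP; rewrite reprK. Qed.

Definition tens (v : V) (w : W) : tensor := \pi_tensor [:: (v, w)].

Definition tscale_seq (a : K) (s : seq (V * W)) : seq (V * W) :=
  [seq (a *: p.1, p.2) | p <- s].

Lemma tscale_seq_rel a s t :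
  tensor_rel s t -> tensor_rel (tscale_seq a s) (tscale_seq a t).
Proof.
elim=> {s t} /=.
- by move=> s; apply: TRefl.
- by move=> s t _; apply: TSym.
- by move=> s t u _ + _; apply: TTrans.
- by move=> s s' t t' _ IHs _ IHt; rewrite /tscale_seq !map_cat; apply: TCat.
- by move=> s t; rewrite /tscale_seq !map_cat; apply: TCatC.
- by move=> w; rewrite scaler0; apply: TZero.
- by move=> v v' w; rewrite scalerDr; apply: TAddl.
- by move=> v w w'; apply: TAddr.
- by move=> b v w; rewrite scalerA mulrC -scalerA; apply: TScale.
Qed.

Definition tensor_zero : tensor := \pi_tensor [::].
(* Locked to keep rewriting from unfolding the quotient. *)
Definition tensor_add : tensor -> tensor -> tensor :=
  locked_with tensor_key (fun x y => \pi_tensor (repr x ++ repr y)).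
Definition tensor_scale : K -> tensor -> tensor :=
  locked_with tensor_key (fun a x => \pi_tensor (tscale_seq a (repr x))).
Definition tensor_opp (x : tensor) : tensor := tensor_scale (-1) x.

Lemma tensor_addE s t :
  tensor_add (\pi_tensor s) (\pi_tensor t) = \pi_tensor (s ++ t).
Proof.
rewrite /tensor_add unlock; apply/tensor_eqP.
by apply: TCat; apply: tensor_repr.
Qed.

Lemma tensor_scaleE a s :
  tensor_scale a (\pi_tensor s) = \pi_tensor (tscale_seq a s).
Proof.
rewrite /tensor_scale unlock; apply/tensor_eqP.
exact: tscale_seq_rel (tensor_repr _).
Qed.

Lemma tensor_addA : associative tensor_add.
Proof.
move=> x y z; elim/quotW: x => s; elim/quotW: y => t; elim/quotW: z => u.
by rewrite !tensor_addE catA.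
Qed.

Lemma tensor_addC : commutative tensor_add.
Proof.
move=> x y; elim/quotW: x => s; elim/quotW: y => t; rewrite !tensor_addE.
by apply/tensor_eqP; apply: TCatC.
Qed.

Lemma tensor_add0 : left_id tensor_zero tensor_add.
Proof. by move=> x; elim/quotW: x => s; rewrite tensor_addE. Qed.

Lemma tensor_rel_cons p (s t : seq (V * W)) :
  tensor_rel (p :: s ++ t) (s ++ p :: t).
Proof.
rewrite -cat1s -[p :: t]cat1s !catA.
by apply: TCat (TRefl _); apply: TCatC.
Qed.

Lemma tscale_seqD a b s :
  tensor_rel (tscale_seq (a + b) s) (tscale_seq a s ++ tscale_seq b s).
Proof.
elim: s => [|[v w] s IHs] /=; first exact: TRefl.
rewrite scalerDl; apply: TTrans (TCat (TAddl _ _ _) IHs) _.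
apply: (TCat (TRefl [:: (a *: v, w)])).
exact: tensor_rel_cons.
Qed.

Lemma tscale_seq0 s : tensor_rel (tscale_seq 0 s) [::].
Proof.
elim: s => [|[v w] s IHs] /=; first exact: TRefl.
by rewrite scale0r; apply: (TCat (TZero _) IHs).
Qed.

Lemma tscale_seq1 s : tscale_seq 1 s = s.
Proof.
by rewrite /tscale_seq -[RHS]map_id; apply: eq_map => -[v w]; rewrite scale1r.
Qed.

Lemma tensor_addN : left_inverse tensor_zero tensor_opp tensor_add.
Proof.
move=> x; elim/quotW: x => s; rewrite /tensor_opp tensor_scaleE tensor_addE.
apply/tensor_eqP; rewrite -[X in _ ++ X]tscale_seq1.
apply: TTrans (TSym (tscale_seqD _ _ _)) _.
by rewrite addNr; apply: tscale_seq0.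
Qed.

HB.instance Definition _ :=
  GRing.isZmodule.Build tensor tensor_addA tensor_addC tensor_add0 tensor_addN.

Lemma tensor_scaleA a b x :
  tensor_scale a (tensor_scale b x) = tensor_scale (a * b) x.
Proof.
elim/quotW: x => s; rewrite !tensor_scaleE.
rewrite /tscale_seq -map_comp.
by congr (\pi_tensor _); apply: eq_map => p /=; rewrite scalerA.
Qed.

Lemma tensor_scale1 : left_id 1 tensor_scale.
Proof. by move=> x; elim/quotW: x => s; rewrite tensor_scaleE tscale_seq1. Qed.

Lemma tensor_scaleDr : right_distributive tensor_scale +%R.
Proof.
move=> a x y; elim/quotW: x => s; elim/quotW: y => t.
by rewrite ![_ + _]tensor_addE !tensor_scaleE [RHS]tensor_addE /tscale_seq map_cat.
Qed.

Lemma tensor_scaleDl x : {morph tensor_scale^~ x : a b / a + b}.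
Proof.
move=> a b; elim/quotW: x => s; rewrite !tensor_scaleE [RHS]tensor_addE.
by apply/tensor_eqP; apply: tscale_seqD.
Qed.

HB.instance Definition _ := GRing.Zmodule_isLmodule.Build K tensor
  tensor_scaleA tensor_scale1 tensor_scaleDr tensor_scaleDl.

Lemma tensE s : \pi_tensor s = \sum_(p <- s) tens p.1 p.2.
Proof.
elim: s => [|[v w] s IHs]; first by rewrite big_nil.
by rewrite big_cons -IHs [RHS]tensor_addE.
Qed.

Lemma tensDl v v' w : tens (v + v') w = tens v w + tens v' w.
Proof. by rewrite [RHS]tensor_addE; apply/tensor_eqP/TAddl. Qed.

Lemma tensDr v w w' : tens v (w + w') = tens v w + tens v w'.
Proof. by rewrite [RHS]tensor_addE; apply/tensor_eqP/TAddr. Qed.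

Lemma tensZl a v w : tens (a *: v) w = a *: tens v w.
Proof. by rewrite [RHS]tensor_scaleE. Qed.

Lemma tensZr a v w : tens v (a *: w) = a *: tens v w.
Proof. by rewrite -tensZl; apply/tensor_eqP/TSym/TScale. Qed.

(* Elimination out of the tensor product (universal property). Only           *)
(* biadditivity and balancedness are required: b may be bilinear, but also    *)
(* conjugate linear in both arguments.                                        *)
Definition balanced (U : zmodType) (b : V -> W -> U) : Prop :=
  [/\ forall v v' w, b (v + v') w = b v w + b v' w,
      forall v w w', b v (w + w') = b v w + b v w' &
      forall a v w, b (a *: v) w = b v (a *: w)].

(* The value does not depend on the representative exactly when b is balanced.*)
Definition tensor_sum (U : zmodType) (b : V -> W -> U) (t : tensor) : U :=
  \sum_(p <- repr t) b p.1 p.2.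

Section Universal.
Variables (U : zmodType) (b : V -> W -> U).
Hypothesis bP : balanced b.

Lemma tensor_rel_sum s t : tensor_rel s t ->
  \sum_(p <- s) b p.1 p.2 = \sum_(p <- t) b p.1 p.2.
Proof.
case: bP => bDl bDr bZ; elim=> {s t}.
- by [].
- by [].
- by move=> s t u _ -> _ ->.
- by move=> s s' t t' _ IHs _ IHt; rewrite !big_cat IHs IHt.
- by move=> s t; rewrite !big_cat /= addrC.
- move=> w; rewrite big_seq1 big_nil /=.
  by apply: (addrI (b 0 w)); rewrite -bDl !addr0.
- by move=> v v' w; rewrite !big_cons !big_nil /= !addr0 bDl.
- by move=> v w w'; rewrite !big_cons !big_nil /= !addr0 bDr.
- by move=> a v w; rewrite !big_seq1 /= bZ.
Qed.

Lemma tensor_sum_pi s :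
  tensor_sum b (\pi_tensor s) = \sum_(p <- s) b p.1 p.2.
Proof. exact/tensor_rel_sum/tensor_repr. Qed.

Lemma tensor_sum_tens v w : tensor_sum b (tens v w) = b v w.
Proof. by rewrite tensor_sum_pi big_seq1. Qed.

Lemma tensor_sum_is_additive : zmod_morphism (tensor_sum b).
Proof.
have sD x y : tensor_sum b (x + y) = tensor_sum b x + tensor_sum b y.
  elim/quotW: x => s; elim/quotW: y => t.
  by rewrite [_ + _]tensor_addE !tensor_sum_pi big_cat.
move=> x y; apply: (addIr (tensor_sum b y)).
by rewrite -sD !subrK.
Qed.

End Universal.

Definition tensor_of_sets (D : set V) (E : set W) : set tensor :=
  [set t | exists2 s : seq (V * W),
     {in s, forall p, D p.1 /\ E p.2} & t = \sum_(p <- s) tens p.1 p.2].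

End Tensor.

Reserved Notation "x ⊗ y" (at level 40, left associativity).
Reserved Notation "\sweedler_ ( x , y <- t ) F"
  (at level 41, F at level 41, x name, y name, t at level 60,
   format "'[' \sweedler_ ( x ,  y  <-  t ) '/  '  F ']'").

Notation "V ⊗ W" := (tensor V W) : type_scope.
Notation "v ⊗ w" := (tens v w) : ring_scope.
Notation "\sweedler_ ( x , y <- t ) F" :=
  (tensor_sum (fun x y => F) t) : ring_scope.

HB.mixin Record isCoalgebra (K : fieldType) C of GRing.Lmodule K C := {
  comul : {linear C -> (C ⊗ C)%type};
  counit : {scalar C};
  comulA : forall c : C,
    \sweedler_(x, c3 <- comul c) \sweedler_(c1, c2 <- comul x) (c1 ⊗ (c2 ⊗ c3))
    = \sweedler_(c1, y <- comul c) (c1 ⊗ comul y);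
  counitl : forall c : C, \sweedler_(c1, c2 <- comul c) (counit c1 *: c2) = c;
  counitr : forall c : C, \sweedler_(c1, c2 <- comul c) (counit c2 *: c1) = c
}.

#[short(type="coalgType")]
HB.structure Definition Coalgebra (K : fieldType) :=
  { C of isCoalgebra K C & GRing.Lmodule K C }.

HB.mixin Record isCircCoalgebra (K : numClosedFieldType) C of Coalgebra K C := {
  circ : {linear C -> C | Num.conj \; *:%R};
  circK : involutive circ;
  comul_circ : forall c : C,
    comul (circ c) = \sweedler_(c1, c2 <- comul c) (circ c2 ⊗ circ c1)
}.

#[short(type="circCoalgType")]
HB.structure Definition CircCoalgebra (K : numClosedFieldType) :=
  { C of isCircCoalgebra K C & Coalgebra K C }.

Definition is_comodule (K : fieldType) (C : coalgType K) (V : lmodType K)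
    (chi : {linear V -> (V ⊗ C)%type}) : Prop :=
  (forall v, \sweedler_(x, c2 <- chi v) \sweedler_(u, c1 <- chi x)
               (u ⊗ (c1 ⊗ c2))
             = \sweedler_(u, c <- chi v) (u ⊗ comul c))
  /\ (forall v, \sweedler_(u, c <- chi v) (counit c *: u) = v).

Section Compactness.
Variables (K : numClosedFieldType) (C : circCoalgType K).

Definition is_unitary (V : lmodType K) (chi : {linear V -> (V ⊗ C)%type})
    (ip : {dot V for Num.conj}) : Prop :=
  forall u v, \sweedler_(u0, u1 <- chi u) (ip u0 v *: u1)
              = \sweedler_(v0, v1 <- chi v) (ip u v0 *: circ v1).

Definition admits_unitary_inner_product (V : lmodType K)
    (chi : {linear V -> (V ⊗ C)%type}) : Prop :=
  exists ip : {dot V for Num.conj}, is_unitary chi ip.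

Definition compact_coalgebra : Prop :=
  forall (V : lmodType K) (chi : {linear V -> (V ⊗ C)%type}),
    is_comodule chi -> admits_unitary_inner_product chi.

Definition fourier_form (w : {biscalar C}) : Prop :=
  forall c d, \sweedler_(d1, d2 <- comul d) (w c d1 *: d2)
              = \sweedler_(c1, c2 <- comul c) (w c2 d *: c1).

(* In a numClosedFieldType, 0 < z says that z is real and positive. *)
Definition posdef_form (w : {biscalar C}) : Prop :=
  forall c, c != 0 -> 0 < w (circ c) c.

Definition hermitian_form (w : {biscalar C}) : Prop :=
  forall c d, w (circ c) (circ d) = (w d c)^*.

Definition fourier_product (m : {bilinear C -> C -> C}) : Prop :=
  forall c d,
    comul (m c d) = \sweedler_(d1, d2 <- comul d) (m c d1 ⊗ d2)
    /\ comul (m c d) = \sweedler_(c1, c2 <- comul c) (c1 ⊗ m c2 d).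

Definition posdef_product (m : {bilinear C -> C -> C}) : Prop :=
  forall c, c != 0 -> 0 < counit (m (circ c) c).

Definition hermitian_product (m : {bilinear C -> C -> C}) : Prop :=
  forall c d, m (circ c) (circ d) = circ (m d c).

End Compactness.

Definition is_direct_sum (K : fieldType) (V : lmodType K) (I : choiceType)
    (D : I -> set V) : Prop :=
  (forall i, submod_closed (mem (D i)))
  /\ forall v, exists! x : I -> V,
       [/\ forall i, D i (x i), finite_set [set i | x i != 0] &
           v = \sum_(i \in [set: I]) x i].

Definition is_subcoalgebra (K : fieldType) (C : coalgType K) (D : set C) : Prop :=
  submod_closed (mem D) /\ forall c, D c -> tensor_of_sets D D (comul c).

Definition is_simple_subcoalgebra (K : fieldType) (C : coalgType K)
    (D : set C) : Prop :=
  [/\ is_subcoalgebra D, D != [set 0] &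
      forall E : set C, is_subcoalgebra E -> E `<=` D -> E = [set 0] \/ E = D].

Definition is_simple_circ_subcoalgebra (K : numClosedFieldType)
    (C : circCoalgType K) (D : set C) : Prop :=
  is_simple_subcoalgebra D /\ circ @` D = D.

Definition is_basis (K : fieldType) (V : lmodType K) (n : nat) (D : set V)
    (t : 'I_n -> 'I_n -> V) : Prop :=
  (forall i j, D (t i j))
  /\ forall v, D v ->
       exists! a : 'M[K]_n, v = \sum_(i < n) \sum_(j < n) a i j *: t i j.

Definition is_unitary_matrix_basis (K : numClosedFieldType)
    (C : circCoalgType K) (D : set C) (n : nat) (t : 'I_n -> 'I_n -> C) : Prop :=
  is_basis D t
  /\ forall i j, comul (t i j) = \sum_(k < n) t i k ⊗ t k j
                 /\ circ (t i j) = t j i.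

(* Main.v *)
(* Fourier forms, Fourier products and unitary inner products on C determine one
   another: w(c, d) = <d, c°> and c * d = sum w(c, d_1) d_2, with inverse
   w(c, d) = eps(c * d).

   From a unitary inner product on C to the decomposition.  Gram-Schmidt in the
   slices of Delta(c) shows that every c lies in the coefficient space of a finite
   unitary corepresentation t, i.e. Delta(t_ij) = sum t_ik (x) t_kj, t_ij° = t_ji,
   eps(t_ij) = delta_ij.  If a non-scalar matrix intertwines t with itself, then so
   does a non-scalar hermitian one; diagonalizing it makes t block diagonal, so by
   induction on the size t may be taken with scalar intertwiners only.  For such t
   unitarity gives the orthogonality relations <t_km, t_ij> = delta_jm L_ki with L
   invertible, hence the t_ij are linearly independent and their span lies in every
   subcoalgebra meeting it nontrivially.  Two distinct such spans D, E are
   orthogonal, because sum <x_1, y> x_2 = sum <x, y_1> y_2° lies in both D and E,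
   which forces it to be 0, and its counit is <x, y>; so their sum is direct.

   From the decomposition to compactness.  The coordinates f_ij of C in the bases
   t^r act on a comodule V by matrix units E^r_ij, and if ( , ) is any inner product
   on V (it exists by a Hamel basis) then <u, v> = sum_r sum_ij (E^r_ij u, E^r_ij v)
   is unitary. *)
From HB Require Import structures.
Require Import Defs.
From mathcomp Require Import all_boot all_order all_algebra.
From mathcomp Require Import finmap all_classical all_reals.
From mathcomp Require Import sesquilinear complex spectral ring.

Set Implicit Arguments.
Unset Strict Implicit.
Unset Printing Implicit Defensive.

Import Order.TTheory GRing.Theory Num.Theory.

Local Open Scope classical_set_scope.
Local Open Scope quotient_scope.
Local Open Scope ring_scope.

(** * Packing forms and products from their algebraic properties *)

(** Conjugate linearity in the second argument comes from linearity in the first and hermitian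
    symmetry. The returned equation lets later proofs replace the packed form by its formula. *)
Lemma dot_exists (K : numClosedFieldType) (V : lmodType K) (f : V -> V -> K) :
  (forall z, scalar (f^~ z)) -> (forall x y, f x y = (f y x)^*) ->
  (forall x, x != 0 -> 0 < f x x) ->
  exists ip : {dot V for Num.conj}, forall x y, ip x y = f x y.
Proof.
move=> fl fC fpos.
have fr x : GRing.linear_for (Num.conj \; *%R) (f x).
  by move=> a y z; rewrite fC fl rmorphD rmorphM /= -!fC.
have fH x y : f x y = (-1) ^+ false * (f y x)^* by rewrite mul1r.
pose bM := bilinear_isBilinear.Build K V V K *%R (Num.conj \; *%R) f (fl, fr).
pose hM := isHermitianSesquilinear.Build K V false Num.conj f fH.
pose dM := isDotProduct.Build K V f fpos.
pose F : {dot V for Num.conj} := HB.pack f bM hM dM.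
by exists F.
Qed.

Lemma biscalar_exists (K : fieldType) (V : lmodType K) (f : V -> V -> K) :
  (forall z, scalar (f^~ z)) -> (forall z, scalar (f z)) ->
  exists w : {biscalar V}, forall x y, w x y = f x y.
Proof.
move=> fl fr.
pose bM := bilinear_isBilinear.Build K V V K *%R *%R f (fl, fr).
pose F : {biscalar V} := HB.pack f bM.
by exists F.
Qed.

Lemma bilinear_exists (K : fieldType) (U V W : lmodType K) (f : U -> V -> W) :
  (forall z, linear (f^~ z)) -> (forall z, linear (f z)) ->
  exists w : {bilinear U -> V -> W}, forall x y, w x y = f x y.
Proof.
move=> fl fr.
pose bM := bilinear_isBilinear.Build K U V W *:%R *:%R f (fl, fr).
pose F : {bilinear U -> V -> W} := HB.pack f bM.
by exists F.
Qed.

(** * Calculus of Sweedler sums *)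

Section TensorSums.
Variables (K : comNzRingType) (V W : lmodType K).

Lemma eq_tsum (U : zmodType) (b b' : V -> W -> U) (t : V ⊗ W) :
  (forall x y, b x y = b' x y) -> tensor_sum b t = tensor_sum b' t.
Proof. by move=> bb'; apply: eq_bigr => p _; rewrite bb'. Qed.

Lemma tsum_tens (t : V ⊗ W) : tensor_sum (@tens K V W) t = t.
Proof. by rewrite -[RHS]reprK tensE. Qed.

Lemma tensor_ind (P : V ⊗ W -> Prop) :
  P 0 -> (forall x y, P x -> P y -> P (x + y)) -> (forall v w, P (v ⊗ w)) ->
  forall t, P t.
Proof. by move=> P0 PD Pt t; rewrite -[t]tsum_tens; apply: big_ind. Qed.

(** The sum runs over the fixed list [repr t], so additivity of [g] suffices; [g 0 = 0] follows by
    cancellation. *)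
Lemma tsum_morph (U U' : zmodType) (g : U -> U') (b : V -> W -> U) (t : V ⊗ W) :
  {morph g : x y / x + y} ->
  g (tensor_sum b t) = tensor_sum (fun x y => g (b x y)) t.
Proof.
move=> gD; apply: big_morph => //.
by apply: (addIr (g 0)); rewrite -gD !add0r.
Qed.

Lemma tsum_split (U : zmodType) (b b' : V -> W -> U) (t : V ⊗ W) :
  tensor_sum (fun x y => b x y + b' x y) t = tensor_sum b t + tensor_sum b' t.
Proof. exact: big_split. Qed.

Lemma tens0r (v : V) : v ⊗ (0 : W) = 0.
Proof. by apply: (addIr (v ⊗ 0)); rewrite -tensDr !add0r. Qed.

Lemma tens_suml (I : Type) (r : seq I) (P : pred I) (F : I -> V) (w : W) :
  (\sum_(i <- r | P i) F i) ⊗ w = \sum_(i <- r | P i) (F i ⊗ w).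
Proof.
apply: (big_morph (fun v => v ⊗ w)) => [x y|]; first exact: tensDl.
by apply: (addIr (0 ⊗ w)); rewrite -tensDl !add0r.
Qed.

Lemma tens_sumr (I : Type) (r : seq I) (P : pred I) (F : I -> W) (v : V) :
  v ⊗ (\sum_(i <- r | P i) F i) = \sum_(i <- r | P i) (v ⊗ F i).
Proof.
apply: (big_morph (fun w => v ⊗ w)) => [x y|]; first exact: tensDr.
exact: tens0r.
Qed.

Section Balanced.
Variables (U : zmodType) (b : V -> W -> U).
Hypothesis bP : balanced b.

Lemma tsumD t t' : tensor_sum b (t + t') = tensor_sum b t + tensor_sum b t'.
Proof.
by have:= tensor_sum_is_additive bP (t + t') t'; rewrite addrK => ->; rewrite subrK.
Qed.

Lemma tsum0 : tensor_sum b 0 = 0.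
Proof. by apply: (addIr (tensor_sum b 0)); rewrite -tsumD !add0r. Qed.

Lemma tsum_sum (I : Type) (r : seq I) (P : pred I) (F : I -> V ⊗ W) :
  tensor_sum b (\sum_(i <- r | P i) F i)
  = \sum_(i <- r | P i) tensor_sum b (F i).
Proof.
apply: big_morph => [x y|]; first exact: tsumD.
by apply: (addIr (tensor_sum b 0)); rewrite -tsumD !add0r.
Qed.

Lemma tsum_sum_tens (I : Type) (r : seq I) (P : pred I) (F : I -> V) (G : I -> W) :
  tensor_sum b (\sum_(i <- r | P i) F i ⊗ G i)
  = \sum_(i <- r | P i) b (F i) (G i).
Proof. by rewrite tsum_sum; apply: eq_bigr => i _; rewrite tensor_sum_tens. Qed.

(** The target is only a [zmodType], so the action of [a] on it is passed as an additive map [s]: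
    scaling for sums with values in a module, multiplication by [a] for scalar ones. *)
Lemma tsum_scale (s : U -> U) (a : K) t :
  {morph s : x y / x + y} -> (forall v w, b (a *: v) w = s (b v w)) ->
  tensor_sum b (a *: t) = s (tensor_sum b t).
Proof.
move=> sD bs; elim/tensor_ind: t => [|x y IHx IHy|v w].
- by rewrite scaler0 tsum0; apply: (addIr (s 0)); rewrite -sD !add0r.
- by rewrite scalerDr !tsumD sD IHx IHy.
- by rewrite -tensZl !tensor_sum_tens.
Qed.

End Balanced.

Lemma tsum_linear (U : lmodType K) (b : V -> W -> U) :
  balanced b -> (forall a v w, b (a *: v) w = a *: b v w) ->
  linear (tensor_sum b).
Proof.
move=> bP bZ a x y; rewrite tsumD//; congr (_ + _).
by apply: tsum_scale => // ? ?; rewrite scalerDr.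
Qed.

End TensorSums.

Lemma tsum_tsum (K : comNzRingType) (V W V' W' : lmodType K) (U : zmodType)
    (b : V' -> W' -> U) (c : V -> W -> V' ⊗ W') (t : V ⊗ W) :
  balanced b ->
  tensor_sum b (tensor_sum c t) = tensor_sum (fun x y => tensor_sum b (c x y)) t.
Proof. by move=> bP; apply: tsum_morph => x y; apply: tsumD. Qed.

Lemma tsum_tsum_tens (K : comNzRingType) (V W V' W' : lmodType K) (U : zmodType)
    (b : V' -> W' -> U) (f : V -> W -> V') (g : V -> W -> W') (t : V ⊗ W) :
  balanced b ->
  tensor_sum b (tensor_sum (fun x y => f x y ⊗ g x y) t)
  = tensor_sum (fun x y => b (f x y) (g x y)) t.
Proof.
move=> bP; rewrite tsum_tsum//.
by apply: eq_tsum => x y; rewrite tensor_sum_tens.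
Qed.

(** The comodule axiom is an identity between tensors; this form transports it along any [T] that
    factors through the triple tensor product, which is what the three conditions on [T] express. *)
Lemma coassoc (K : fieldType) (C : coalgType K) (V : lmodType K)
    (chi : {linear V -> (V ⊗ C)%type}) (U : zmodType) (T : V -> C -> C -> U) :
  is_comodule chi -> (forall v, balanced (T v)) ->
  (forall v v' c d, T (v + v') c d = T v c d + T v' c d) ->
  (forall a v c d, T (a *: v) c d = T v (a *: c) d) ->
  forall v, \sweedler_(x, c2 <- chi v) \sweedler_(u, c1 <- chi x) T u c1 c2
            = \sweedler_(u, c <- chi v) \sweedler_(c1, c2 <- comul c) T u c1 c2.
Proof.
move=> [chiA _] TP TD TZ v.
(* The map induced by [T] on pairs from [V] and [C ⊗ C]; it is applied to both sides of the axiom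
   [chiA v]. *)
have bP : balanced (fun u z => tensor_sum (T u) z).
  split=> [u u' z|u z z'|a u z].
  - by rewrite -tsum_split; apply: eq_tsum.
  - exact: tsumD.
  - elim/tensor_ind: z => [|x y IHx IHy|c d].
    + by rewrite scaler0 !tsum0.
    + by rewrite scalerDr !tsumD// IHx IHy.
    + by rewrite -tensZl !tensor_sum_tens.
have := congr1 (tensor_sum (fun u z => tensor_sum (T u) z)) (chiA v).
rewrite !tsum_tsum// => eqT.
transitivity (\sweedler_(x, c3 <- chi v) tensor_sum (fun u z => tensor_sum (T u) z)
    (\sweedler_(u, c1 <- chi x) (u ⊗ (c1 ⊗ c3)))).
  apply: eq_tsum => x c3; rewrite tsum_tsum//; apply: eq_tsum => u c1.
  by rewrite !tensor_sum_tens.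
by rewrite eqT; apply: eq_tsum => u c; rewrite tensor_sum_tens.
Qed.

Section BalancedScale.
Variables (K : comNzRingType) (V W U : lmodType K) (s : K -> K).

(** The map [s] is [id] for bilinear summands and [Num.conj] when both factors are conjugate linear,
    as in [ip u v0 *: circ v1]. *)
Lemma balanced_scalel (f : V -> K) (g : W -> U) :
  {morph f : x y / x + y} -> {morph g : x y / x + y} ->
  (forall a v, f (a *: v) = s a * f v) -> (forall a w, g (a *: w) = s a *: g w) ->
  balanced (fun v w => f v *: g w).
Proof.
move=> fD gD fZ gZ; split=> [v v' w|v w w'|a v w].
- by rewrite fD scalerDl.
- by rewrite gD scalerDr.
- by rewrite fZ gZ scalerA mulrC.
Qed.

Lemma balanced_scaler (f : V -> U) (g : W -> K) :
  {morph f : x y / x + y} -> {morph g : x y / x + y} ->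
  (forall a v, f (a *: v) = s a *: f v) -> (forall a w, g (a *: w) = s a * g w) ->
  balanced (fun v w => g w *: f v).
Proof.
move=> fD gD fZ gZ; split=> [v v' w|v w w'|a v w].
- by rewrite fD scalerDr.
- by rewrite gD scalerDl.
- by rewrite fZ gZ scalerA mulrC.
Qed.

End BalancedScale.
Arguments balanced_scalel {K V W U} s.
Arguments balanced_scaler {K V W U} s.

(** * Fourier forms and products *)

Section FourierForms.
Variables (K : numClosedFieldType) (C : circCoalgType K).
Implicit Types c d : C.

Lemma circ_circ c : circ (circ c) = c. Proof. exact: circK. Qed.

Lemma circD c d : circ (c + d) = circ c + circ d. Proof. exact: linearD. Qed.

Lemma circZ a c : circ (a *: c) = a^* *: circ c. Proof. exact: linearZ. Qed.

Lemma counitD c d : counit (c + d) = counit c + counit d.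
Proof. exact: linearD. Qed.

Lemma counitZ a c : counit (a *: c) = a * counit c.
Proof. exact: linearZ. Qed.

Lemma comodule_comul : is_comodule (comul : {linear C -> (C ⊗ C)%type}).
Proof. by split; [exact: comulA | exact: counitr]. Qed.

Lemma comulZ a c : comul (a *: c) = a *: comul c.
Proof. exact: linearZ. Qed.

Lemma circ_sum (I : Type) (r : seq I) (P : pred I) (F : I -> C) :
  circ (\sum_(i <- r | P i) F i) = \sum_(i <- r | P i) circ (F i).
Proof. exact: raddf_sum. Qed.

Lemma counit_sum (I : Type) (r : seq I) (P : pred I) (F : I -> C) :
  counit (\sum_(i <- r | P i) F i) = \sum_(i <- r | P i) counit (F i).
Proof. exact: raddf_sum. Qed.

Lemma comul_sum (I : Type) (r : seq I) (P : pred I) (F : I -> C) :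
  comul (\sum_(i <- r | P i) F i) = \sum_(i <- r | P i) comul (F i).
Proof. exact: raddf_sum. Qed.

Lemma tsum_comul_circ (U : zmodType) (b : C -> C -> U) c :
  balanced b -> tensor_sum b (comul (circ c))
                = \sweedler_(c1, c2 <- comul c) b (circ c2) (circ c1).
Proof. by move=> bP; rewrite comul_circ tsum_tsum_tens. Qed.

(** Uniqueness of the counit: the functional sending [d] to [(counit (circ d))^*] satisfies the left
    counit law because [circ] reverses [comul]. A left counit and a right counit agree, since both
    equal their convolution product. *)
Lemma counit_circ c : counit (circ c) = (counit c)^*.
Proof.
have epsl d : \sweedler_(d1, d2 <- comul d) ((counit (circ d1))^* *: d2) = d.
  have bP : balanced (fun c1 c2 : C => counit c2 *: c1).
    by apply: (balanced_scaler id) => // [x y|a x]; rewrite ?counitD ?counitZ.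
  rewrite -[RHS]circ_circ -[circ d in RHS]counitr tsum_comul_circ//.
  rewrite (tsum_morph (g := circ)); last exact: circD.
  by apply: eq_tsum => x y; rewrite circZ circ_circ.
apply: (can_inj conjCK); rewrite conjCK.
rewrite -[c in LHS]counitr -[c in RHS]epsl.
rewrite (tsum_morph (g := fun x => (counit (circ x))^*)); last first.
  by move=> x y; rewrite circD counitD rmorphD.
rewrite (tsum_morph (g := counit)); last exact: raddfD.
by apply: eq_tsum => x y; rewrite circZ !counitZ rmorphM /= conjCK mulrC.
Qed.

(** Unitarity for the pair [d], [circ c] is the Fourier identity: [comul (circ c)] swaps the two
    legs, and the [circ] in the unitarity condition cancels the one on [c1]. *)
Lemma fourier_form_of_unitary (ip : {dot C for Num.conj}) :
  Defs.is_unitary comul ip ->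
  exists w : {biscalar C}, [/\ fourier_form w, posdef_form w & hermitian_form w].
Proof.
move=> uip.
have [||w wE] := @biscalar_exists K C (fun c d => ip d (circ c)).
- by move=> d a x y; rewrite linearP linearD linearZ /= conjCK.
- by move=> c a x y; rewrite linearPl.
exists w; split.
- move=> c d; under eq_tsum do rewrite wE.
  rewrite uip tsum_comul_circ; last first.
    apply: (balanced_scalel Num.conj); [exact: linearDr|exact: circD| |exact: circZ].
    by move=> a x; rewrite linearZr_LR.
  by apply: eq_tsum => x y; rewrite wE circ_circ.
- by move=> c c0; rewrite wE circ_circ neq0_dnorm_gt0.
- by move=> c d; rewrite !wE circ_circ hermC mul1r.
Qed.

(** The Fourier identity gives a second formula for the product, with the sum over [comul c].
    Coassociativity applied to each formula yields one half of [fourier_product]; [circ] exchanges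
    the formulas, whence hermitian symmetry. Positivity holds because the counit of the product is
    [w]. *)
Lemma fourier_product_of_form (w : {biscalar C}) :
  fourier_form w -> posdef_form w -> hermitian_form w ->
  exists m : {bilinear C -> C -> C},
    [/\ fourier_product m, posdef_product m & hermitian_product m].
Proof.
move=> wF wpos wH.
have bl c : balanced (fun d1 d2 => w c d1 *: d2).
  apply: (balanced_scalel id) => // [x y|a x]; first by rewrite linearDr.
  by rewrite linearZr_LR.
have br d : balanced (fun c1 c2 => w c2 d *: c1).
  apply: (balanced_scaler id) => // [x y|a x]; first by rewrite linearDl.
  by rewrite linearZl_LR.
have [||m mE] := @bilinear_exists K C C C
  (fun c d => \sweedler_(d1, d2 <- comul d) (w c d1 *: d2)).
- move=> d a x y; rewrite (tsum_morph (g := GRing.scale a)); last exact: scalerDr.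
  rewrite -tsum_split; apply: eq_tsum => d1 d2.
  by rewrite linearPl /= scalerDl scalerA.
- move=> c a x y; rewrite linearP.
  by apply: tsum_linear => // b v u; rewrite linearZr_LR /= scalerA.
exists m; split.
- move=> c d; split.
    transitivity (\sweedler_(d1, d2 <- comul d) (w c d1 *: comul d2)).
      rewrite mE (tsum_morph (g := comul)); last exact: raddfD.
      by apply: eq_tsum => d1 d2; rewrite linearZ.
    transitivity (\sweedler_(x, d3 <- comul d) \sweedler_(d1, d2 <- comul x)
                    (w c d1 *: (d2 ⊗ d3))).
      rewrite (coassoc comodule_comul) => [|v|v v' u u'|a v u u'].
      + apply: eq_tsum => d1 y; rewrite -[comul y in LHS]tsum_tens.
        by rewrite (tsum_morph (g := GRing.scale (w c d1))); last exact: scalerDr.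
      + by split=> *; rewrite ?tensDl ?tensDr ?tensZl ?tensZr ?scalerDr.
      + by rewrite linearDr scalerDl.
      + by rewrite linearZr_LR /= tensZl scalerA mulrC.
    apply: eq_tsum => x d3; rewrite mE (tsum_morph (g := fun z => z ⊗ d3)).
      by apply: eq_tsum => d1 d2; rewrite tensZl.
    by move=> u v; rewrite tensDl.
  transitivity (\sweedler_(c1, c2 <- comul c) (w c2 d *: comul c1)).
    rewrite mE wF (tsum_morph (g := comul)); last exact: raddfD.
    by apply: eq_tsum => c1 c2; rewrite linearZ.
  transitivity (\sweedler_(c1, y <- comul c) \sweedler_(c2, c3 <- comul y)
                  (w c3 d *: (c1 ⊗ c2))).
    rewrite -(coassoc comodule_comul) => [|v|v v' u u'|a v u u'].
    + apply: eq_tsum => x c3; rewrite -[comul x in LHS]tsum_tens.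
      by rewrite (tsum_morph (g := GRing.scale (w c3 d))); last exact: scalerDr.
    + split=> *; rewrite ?tensDr ?linearDl ?scalerDl ?scalerDr//.
      by rewrite linearZl_LR /= tensZr scalerA mulrC.
    + by rewrite tensDl scalerDr.
    + by rewrite tensZl tensZr.
  apply: eq_tsum => c1 y; rewrite mE wF (tsum_morph (g := fun z => c1 ⊗ z)).
    by apply: eq_tsum => c2 c3; rewrite tensZr.
  by move=> u v; rewrite tensDr.
- move=> c c0; suff -> : counit (m (circ c) c) = w (circ c) c by apply: wpos.
  rewrite mE (tsum_morph (g := counit)); last exact: raddfD.
  rewrite -[X in _ = w _ X]counitr (tsum_morph (g := w (circ c))); last exact: linearDr.
  by apply: eq_tsum => c1 c2; rewrite linearZr_LR counitZ mulrC.
- move=> c d; rewrite !mE tsum_comul_circ; last exact: bl.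
  rewrite wF (tsum_morph (g := circ)); last exact: raddfD.
  by apply: eq_tsum => d1 d2; rewrite wH circZ.
Qed.

(** With the form [counit (m (circ v) u)], the counit laws applied to the two expressions for
    [comul (m c d)] show that both sides of the unitarity condition equal [m (circ v) u]. *)
Lemma unitary_of_fourier_product (m : {bilinear C -> C -> C}) :
  fourier_product m -> posdef_product m -> hermitian_product m ->
  admits_unitary_inner_product (comul : {linear C -> (C ⊗ C)%type}).
Proof.
move=> mF mpos mH.
have epsl x (d : C) : \sweedler_(d1, d2 <- comul d) (counit (m x d1) *: d2) = m x d.
  rewrite -[RHS]counitl (mF x d).1 tsum_tsum_tens//.
  by apply: (balanced_scalel id) => // [y z|a y]; rewrite ?counitD ?counitZ.
have epsr x (c : C) : \sweedler_(c1, c2 <- comul c) (counit (m c2 x) *: c1) = m c x.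
  rewrite -[RHS]counitr (mF c x).2 tsum_tsum_tens//.
  by apply: (balanced_scaler id) => // [y z|a y]; rewrite ?counitD ?counitZ.
have [|||ip ipE] := @dot_exists K C (fun u v => counit (m (circ v) u)).
- by move=> v a x y; rewrite linearPr linearP.
- by move=> u v; rewrite -counit_circ -mH circ_circ.
- exact: mpos.
exists ip => u v.
rewrite (eq_tsum _ (fun u0 u1 => congr1 (fun a => a *: u1) (ipE u0 v))) epsl.
rewrite -epsr tsum_comul_circ; last first.
  apply: (balanced_scaler id) => // [x y|a x]; first by rewrite linearDl counitD.
  by rewrite linearZl_LR counitZ.
by apply: eq_tsum => v0 v1; rewrite ipE.
Qed.

End FourierForms.

(** * Orthonormal families *)

(** A counterpart of [submod_closed] for [Prop]-valued predicates, so that an arbitrary property can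
    serve as the motive of the induction principles below. *)
Definition lin_closed (K : pzRingType) (V : lmodType K) (P : V -> Prop) : Prop :=
  P 0 /\ forall a x y, P x -> P y -> P (a *: x + y).

Lemma lin_closed_sum (K : pzRingType) (V : lmodType K) (P : V -> Prop)
    (I : Type) (r : seq I) (Q : pred I) (a : I -> K) (F : I -> V) :
  lin_closed P -> (forall i, Q i -> P (F i)) ->
  P (\sum_(i <- r | Q i) a i *: F i).
Proof.
move=> [P0 Pl] PF; elim: r => [|i r IHr]; first by rewrite big_nil.
by rewrite big_cons; case: ifP => // Qi; apply: Pl => //; apply: PF.
Qed.

Section GramSchmidt.
Variables (K : numClosedFieldType) (V : lmodType K) (ip : {dot V for Num.conj}).

Definition orthonormal_family n (e : 'I_n -> V) : Prop :=
  forall i j, ip (e i) (e j) = (i == j)%:R.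

Lemma dotC x y : ip x y = (ip y x)^*.
Proof. by rewrite hermC mul1r. Qed.

Lemma dotZl a x y : ip (a *: x) y = a * ip x y.
Proof. by rewrite linearZl_LR. Qed.

Lemma dotZr a x y : ip x (a *: y) = a^* * ip x y.
Proof. by rewrite linearZr_LR. Qed.

Lemma dotDl x y z : ip (x + y) z = ip x z + ip y z.
Proof. by rewrite linearDl. Qed.

Lemma dotDr x y z : ip x (y + z) = ip x y + ip x z.
Proof. by rewrite linearDr. Qed.

Lemma dotBl x y z : ip (x - y) z = ip x z - ip y z.
Proof. by rewrite linearBl. Qed.

Lemma dot_suml (I : Type) (r : seq I) (P : pred I) (F : I -> V) y :
  ip (\sum_(i <- r | P i) F i) y = \sum_(i <- r | P i) ip (F i) y.
Proof. by rewrite linear_sumlz. Qed.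

Lemma dot_suml_onf n (e : 'I_n -> V) (a : 'I_n -> K) j :
  orthonormal_family e -> ip (\sum_i a i *: e i) (e j) = a j.
Proof.
move=> eo; rewrite dot_suml (bigD1 j)//= big1 => [|i ij].
  by rewrite dotZl eo eqxx mulr1 addr0.
by rewrite dotZl eo (negPf ij) mulr0.
Qed.

(** The last clause places every [e i] in the span of [s], phrased as inheritance of linear
    properties. *)
Lemma gram_schmidt (s : seq V) :
  exists n (e : 'I_n -> V),
    [/\ orthonormal_family e,
        {in s, forall x, x = \sum_i ip x (e i) *: e i} &
        forall P, lin_closed P -> {in s, forall x, P x} -> forall i, P (e i)].
Proof.
elim: s => [|v s [n [e [eo es eP]]]].
  by exists 0%N, (fun=> 0); split=> // [[]//|P _ _ []//].
pose p := \sum_i ip v (e i) *: e i.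
have [vp|] := eqVneq (v - p) 0.
  exists n, e; split=> // [x|P Pl Ps i].
    rewrite inE => /predU1P[->|/es//].
    by apply/eqP; rewrite -subr_eq0 vp.
  by apply: eP => // x xs; apply: Ps; rewrite inE xs orbT.
set w := v - p => w0.
have we j : ip w (e j) = 0 by rewrite dotBl dot_suml_onf// subrr.
have ww : 0 < ip w w by exact: neq0_dnorm_gt0.
(* The normalizing factor of the residual [w]; it is real, so it leaves either argument of [ip]
   without conjugation. *)
pose r := (sqrtC (ip w w))^-1.
have rr : r * r * ip w w = 1.
  by rewrite -expr2 exprVn sqrtCK mulVf// gt_eqF.
have rC : r^* = r by rewrite conj_Creal// realV ger0_real// sqrtC_ge0 ltW.
(* The new vector gets index [ord0], and the old family is shifted by [lift ord0]. *)
pose e' (i : 'I_n.+1) := if unlift ord0 i is Some j then e j else r *: w.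
have e'0 : e' ord0 = r *: w by rewrite /e' unlift_none.
have e'S j : e' (lift ord0 j) = e j by rewrite /e' liftK.
have eu j : ip (e j) (r *: w) = 0 by rewrite dotZr dotC we rmorph0 mulr0.
exists n.+1, e'; split.
- move=> i j; case: (unliftP ord0 i) => [i'|] ->; case: (unliftP ord0 j) => [j'|] ->.
  + by rewrite !e'S eo (inj_eq lift_inj).
  + by rewrite e'S e'0 eu eq_sym (negPf (neq_lift _ _)).
  + by rewrite e'S e'0 dotZl we mulr0 (negPf (neq_lift _ _)).
  + by rewrite e'0 dotZl dotZr rC mulrA rr eqxx.
- move=> x; rewrite big_ord_recl e'0 inE => xs.
  under eq_bigr do rewrite e'S.
  case/predU1P: xs => [->|xs].
    have pu : ip p (r *: w) = 0.
      by rewrite dot_suml big1// => i _; rewrite dotZl eu mulr0.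
    rewrite -{1 2}[v](subrK p) dotDl pu addr0 dotZr rC scalerA mulrAC rr scale1r.
    by [].
  rewrite {2}[x](es x xs) dot_suml big1 ?scale0r ?add0r; first exact: es.
  by move=> i _; rewrite dotZl eu mulr0.
- move=> P Pl Ps i.
  have Pe j : P (e j).
    by apply: eP => // x xs; apply: Ps; rewrite inE xs orbT.
  case: (unliftP ord0 i) => [i'|] ->; rewrite ?e'S// e'0.
  rewrite -[r *: w]addr0; apply: Pl.2 Pl.1.
  rewrite /w addrC -scaleN1r; apply: Pl.2; first exact: lin_closed_sum.
  by apply: Ps; rewrite mem_head.
Qed.

End GramSchmidt.

(** * Unitary corepresentations *)

(** The counit clause is a genuine condition: the zero matrix satisfies the other two. *)
Definition unitary_corep (K : numClosedFieldType) (C : circCoalgType K) n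
    (t : 'I_n -> 'I_n -> C) : Prop :=
  [/\ forall i j, comul (t i j) = \sum_(k < n) t i k ⊗ t k j,
      forall i j, circ (t i j) = t j i &
      forall i j, counit (t i j) = (i == j)%:R].

Section Slices.
Variables (K : numClosedFieldType) (C : circCoalgType K).
Variables (ip : {dot C for Num.conj}) (v : C).

Lemma lslice_balanced : balanced (fun x y : C => ip x v *: y).
Proof.
apply: (balanced_scalel id) => // [x y|a x]; [exact: dotDl|exact: dotZl].
Qed.

Lemma rslice_balanced : balanced (fun x y : C => ip y v *: x).
Proof.
apply: (balanced_scaler id) => // [x y|a x]; [exact: dotDl|exact: dotZl].
Qed.

Definition lslice (x : C) : C := \sweedler_(x1, x2 <- comul x) (ip x1 v *: x2).
Definition rslice (x : C) : C := \sweedler_(x1, x2 <- comul x) (ip x2 v *: x1).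

Lemma lsliceD : {morph lslice : x y / x + y}.
Proof. by move=> x y; rewrite /lslice linearD tsumD//; apply: lslice_balanced. Qed.

Lemma lsliceZ a x : lslice (a *: x) = a *: lslice x.
Proof.
rewrite /lslice comulZ; apply: tsum_scale => [|y z|y z].
- exact: lslice_balanced.
- exact: scalerDr.
- by rewrite dotZl scalerA.
Qed.

Lemma rsliceD : {morph rslice : x y / x + y}.
Proof. by move=> x y; rewrite /rslice linearD tsumD//; apply: rslice_balanced. Qed.

Lemma rsliceZ a x : rslice (a *: x) = a *: rslice x.
Proof.
rewrite /rslice comulZ; apply: tsum_scale => [|y z|y z].
- exact: rslice_balanced.
- exact: scalerDr.
- by rewrite !scalerA mulrC.
Qed.

End Slices.

Section LocalFiniteness.
Variables (K : numClosedFieldType) (C : circCoalgType K).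
Variables (ip : {dot C for Num.conj}).
Hypothesis uip : Defs.is_unitary comul ip.

(** The span of [v] is a right coideal, and orthonormality recovers [t k i] as the slice
    [lslice ip (v k) (v i)]. The three clauses then come from coassociativity, from unitarity of
    [ip] and from the right counit law. *)
Lemma unitary_corep_of_coideal n (v : 'I_n -> C) (t : 'I_n -> 'I_n -> C) :
  orthonormal_family ip v -> (forall i, comul (v i) = \sum_j v j ⊗ t j i) ->
  unitary_corep t.
Proof.
move=> vo vt.
have sliceE k i : lslice ip (v k) (v i) = t k i.
  rewrite /lslice vt tsum_sum_tens; last exact: lslice_balanced.
  rewrite (bigD1 k)//= vo eqxx scale1r big1 ?addr0//.
  by move=> j jk; rewrite vo (negPf jk) scale0r.
split.
- move=> k i; rewrite -{1}sliceE /lslice (tsum_morph (g := comul)); last exact: linearD.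
  transitivity (\sweedler_(u, c <- comul (v i)) \sweedler_(c1, c2 <- comul c)
                  (ip u (v k) *: (c1 ⊗ c2))).
    apply: eq_tsum => u c; rewrite comulZ -[comul c in LHS]tsum_tens.
    by rewrite (tsum_morph (g := GRing.scale (ip u (v k)))); last exact: scalerDr.
  rewrite -(coassoc (comodule_comul C)) => [|u|u u' c d|a u c d].
  + transitivity (\sweedler_(x, c2 <- comul (v i)) (lslice ip (v k) x ⊗ c2)).
      apply: eq_tsum => x c2; rewrite (tsum_morph (g := fun z => z ⊗ c2)).
        by apply: eq_tsum => u c1; rewrite tensZl.
      by move=> y z; rewrite tensDl.
    rewrite vt tsum_sum_tens; first by apply: eq_bigr => j _; rewrite sliceE.
    split=> [x x' y|x y y'|a x y].
    * by rewrite lsliceD tensDl.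
    * exact: tensDr.
    * by rewrite lsliceZ tensZl tensZr.
  + by split=> *; rewrite ?tensDl ?tensDr ?tensZl ?tensZr ?scalerDr.
  + by rewrite dotDl scalerDl.
  + by rewrite dotZl tensZl scalerA mulrC.
- move=> i j; have := uip (v i) (v j); rewrite -/(lslice _ _ _) sliceE => ->.
  rewrite vt tsum_sum_tens.
    rewrite (bigD1 i)//= vo eqxx scale1r big1 ?addr0// => k ki.
    by rewrite vo eq_sym (negPf ki) scale0r.
  apply: (balanced_scalel Num.conj); last exact: circZ.
  + exact: dotDr.
  + exact: circD.
  + by move=> a x; rewrite dotZr.
- move=> i j; have := counitr (v j).
  rewrite vt tsum_sum_tens; last first.
    by apply: (balanced_scaler id) => // [x y|a x]; rewrite ?counitD ?counitZ.
  move/(congr1 (fun x => ip x (v i))); rewrite dot_suml_onf// => ->.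
  by rewrite vo eq_sym.
Qed.

(** Every [c] lies in a finite-dimensional right coideal, namely the span of the left legs [a k] of
    [comul c]. An orthonormal basis of it gives a unitary corepresentation whose entries span that
    basis and hence [c]. *)
Lemma unitary_corep_ind (P : C -> Prop) :
  lin_closed P ->
  (forall n (t : 'I_n -> 'I_n -> C), unitary_corep t -> forall i j, P (t i j)) ->
  forall c, P c.
Proof.
move=> Pl Pt c.
(* Orthonormalizing the right legs of [comul c] lets the left legs be written as slices of [c]. *)
have [m [b [bo bs _]]] := gram_schmidt ip [seq p.2 | p <- repr (comul c)].
pose a k := rslice ip (b k) c.
have ca : comul c = \sum_k a k ⊗ b k.
  rewrite -[LHS]tsum_tens /tensor_sum.
  transitivity (\sum_(p <- repr (comul c)) \sum_k (ip p.2 (b k) *: p.1) ⊗ b k).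
    apply: eq_big_seq => p pc; rewrite {1}(bs p.2) ?map_f// tens_sumr.
    by apply: eq_bigr => k _; rewrite tensZl tensZr.
  rewrite exchange_big; apply: eq_bigr => k _ /=.
  by rewrite -tens_suml.
have aE l : comul (a l) = \sum_k a k ⊗ rslice ip (b l) (b k).
  rewrite [in LHS]/a [in LHS]/rslice (tsum_morph (g := comul)); last exact: linearD.
  transitivity (\sweedler_(x, c3 <- comul c) \sweedler_(c1, c2 <- comul x)
                  (ip c3 (b l) *: (c1 ⊗ c2))).
    apply: eq_tsum => x c3; rewrite comulZ -[comul x in LHS]tsum_tens.
    by rewrite (tsum_morph (g := GRing.scale (ip c3 (b l)))); last exact: scalerDr.
  rewrite (coassoc (comodule_comul C)) => [|u|u u' x y|r u x y].
  + transitivity (\sweedler_(x, y <- comul c) (x ⊗ rslice ip (b l) y)).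
      apply: eq_tsum => x y; rewrite (tsum_morph (g := fun z => x ⊗ z)).
        by apply: eq_tsum => u c1; rewrite tensZr.
      by move=> z z'; rewrite tensDr.
    rewrite ca tsum_sum_tens//.
    split=> [x x' y|x y y'|r x y].
    * exact: tensDl.
    * by rewrite rsliceD tensDr.
    * by rewrite rsliceZ tensZl tensZr.
  + split=> *; rewrite ?tensDr ?dotDl ?scalerDl ?scalerDr//.
    by rewrite dotZl tensZr scalerA mulrC.
  + by rewrite tensDl scalerDr.
  + by rewrite tensZl tensZr.
(* The [a k] may be dependent; [v] is an orthonormal basis of their span. *)
have [n [v [vo vs vP]]] := gram_schmidt ip [seq a k | k <- enum 'I_m].
have avE k : a k = \sum_i ip (a k) (v i) *: v i.
  by apply: vs; apply: map_f; rewrite mem_enum.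
have /choice[z zE] i : exists z : 'I_n -> C, comul (v i) = \sum_j v j ⊗ z j.
  (* Having coproduct of the shape [\sum_k a k ⊗ z k] is a linear condition, so it passes from the
     [a k] to their span through [vP]. *)
  have [z ->] : exists z : 'I_m -> C, comul (v i) = \sum_k a k ⊗ z k.
    pose P' x := exists z : 'I_m -> C, comul x = \sum_k a k ⊗ z k.
    apply: (vP P') => [|x /mapP[k _ ->]]; last first.
      by exists (fun l => rslice ip (b k) (b l)).
    split=> [|r x y [z xz] [z' yz]].
      by exists (fun=> 0); rewrite linear0 big1// => k _; rewrite tens0r.
    exists (fun k => r *: z k + z' k); rewrite linearP xz yz scaler_sumr -big_split.
    by apply: eq_bigr => k _; rewrite tensDr tensZr.
  exists (fun j => \sum_k ip (a k) (v j) *: z k).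
  transitivity (\sum_k \sum_j v j ⊗ (ip (a k) (v j) *: z k)).
    apply: eq_bigr => k _; rewrite {1}avE tens_suml.
    by apply: eq_bigr => j _; rewrite tensZl tensZr.
  by rewrite exchange_big; apply: eq_bigr => j _; rewrite tens_sumr.
(* In [zE] the row index of [z] is the one of the expanded vector, so the corepresentation is the
   transpose of [z]. *)
have tP := @unitary_corep_of_coideal n v (fun j i => z i j) vo zE.
have Pv i : P (v i).
  rewrite -[v i]counitl zE tsum_sum_tens.
    by apply: lin_closed_sum => // j _; apply: (Pt _ _ tP).
  by apply: (balanced_scalel id) => // [x y|r x]; rewrite ?counitD ?counitZ.
rewrite -[c]counitr ca tsum_sum_tens.
  by apply: lin_closed_sum => // k _; rewrite avE; apply: lin_closed_sum.
by apply: (balanced_scaler id) => // [x y|r x]; rewrite ?counitD ?counitZ.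
Qed.

End LocalFiniteness.

(** * Intertwiners *)

Section MatrixActions.
Variables (K : comNzRingType) (V : lmodType K) (n : nat).
Implicit Types (X Y : 'M[K]_n) (t : 'I_n -> 'I_n -> V).

Definition lact X t i j : V := \sum_k X i k *: t k j.
Definition ract t X i j : V := \sum_k X k j *: t i k.

Lemma lactM X Y t : lact (X *m Y) t = lact X (lact Y t).
Proof.
apply/funext => i; apply/funext => j.
transitivity (\sum_l \sum_k (X i k * Y k l) *: t l j).
  by apply: eq_bigr => l _; rewrite mxE scaler_suml.
rewrite exchange_big; apply: eq_bigr => k _; rewrite scaler_sumr.
by apply: eq_bigr => l _; rewrite scalerA.
Qed.

Lemma ractM t X Y : ract t (X *m Y) = ract (ract t X) Y.
Proof.
apply/funext => i; apply/funext => j.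
transitivity (\sum_l \sum_k (X l k * Y k j) *: t i l).
  by apply: eq_bigr => l _; rewrite mxE scaler_suml.
rewrite exchange_big; apply: eq_bigr => k _; rewrite scaler_sumr.
by apply: eq_bigr => l _; rewrite scalerA mulrC.
Qed.

Lemma lact_ract X t Y : lact X (ract t Y) = ract (lact X t) Y.
Proof.
apply/funext => i; apply/funext => j.
transitivity (\sum_k \sum_l (X i k * Y l j) *: t k l).
  apply: eq_bigr => k _; rewrite scaler_sumr.
  by apply: eq_bigr => l _; rewrite scalerA.
rewrite exchange_big; apply: eq_bigr => k _; rewrite scaler_sumr.
by apply: eq_bigr => l _; rewrite scalerA mulrC.
Qed.

Lemma lact_scalar a t : lact a%:M t = fun i j => a *: t i j.
Proof.
apply/funext => i; apply/funext => j.
rewrite /lact (bigD1 i)//= mxE eqxx big1 ?addr0// => k ki.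
by rewrite mxE eq_sym (negPf ki) scale0r.
Qed.

Lemma ract_scalar a t : ract t a%:M = fun i j => a *: t i j.
Proof.
apply/funext => i; apply/funext => j.
rewrite /ract (bigD1 j)//= mxE eqxx big1 ?addr0// => k kj.
by rewrite mxE (negPf kj) scale0r.
Qed.

Lemma lact1 t : lact 1%:M t = t.
Proof.
by rewrite lact_scalar; apply/funext => i; apply/funext => j; rewrite scale1r.
Qed.

Lemma ract1 t : ract t 1%:M = t.
Proof.
by rewrite ract_scalar; apply/funext => i; apply/funext => j; rewrite scale1r.
Qed.

Lemma lact_diag (d : 'rV[K]_n) t i j : lact (diag_mx d) t i j = d 0 i *: t i j.
Proof.
rewrite /lact (bigD1 i)//= mxE eqxx big1 ?addr0// => k ki.
by rewrite mxE eq_sym (negPf ki) scale0r.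
Qed.

Lemma ract_diag (d : 'rV[K]_n) t i j : ract t (diag_mx d) i j = d 0 j *: t i j.
Proof.
rewrite /ract (bigD1 j)//= mxE eqxx big1 ?addr0// => k kj.
by rewrite mxE (negPf kj) scale0r.
Qed.

Lemma lactD X Y t i j : lact (X + Y) t i j = lact X t i j + lact Y t i j.
Proof. by rewrite -big_split; apply: eq_bigr => k _; rewrite mxE scalerDl. Qed.

Lemma ractD X Y t i j : ract t (X + Y) i j = ract t X i j + ract t Y i j.
Proof. by rewrite -big_split; apply: eq_bigr => k _; rewrite mxE scalerDl. Qed.

Lemma lactZ a X t i j : lact (a *: X) t i j = a *: lact X t i j.
Proof. by rewrite scaler_sumr; apply: eq_bigr => k _; rewrite mxE scalerA. Qed.

Lemma ractZ a X t i j : ract t (a *: X) i j = a *: ract t X i j.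
Proof. by rewrite scaler_sumr; apply: eq_bigr => k _; rewrite mxE scalerA. Qed.

(** A scalar matrix moves across the tensor sign. In the coproduct of a conjugated corepresentation
    this brings the inner factors [Q] and [P] together, where they cancel. *)
Lemma tens_ract_lact (W : lmodType K) t X (s : 'I_n -> 'I_n -> W) i j :
  \sum_k ract t X i k ⊗ s k j
  = \sum_k t i k ⊗ (\sum_l X k l *: s l j).
Proof.
transitivity (\sum_k \sum_l X l k *: (t i l ⊗ s k j)).
  apply: eq_bigr => k _; rewrite tens_suml.
  by apply: eq_bigr => l _; rewrite tensZl.
rewrite exchange_big; apply: eq_bigr => k _; rewrite tens_sumr.
by apply: eq_bigr => l _; rewrite tensZr.
Qed.

End MatrixActions.

Definition intertwines (K : comNzRingType) (V : lmodType K) n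
    (t : 'I_n -> 'I_n -> V) (X : 'M[K]_n) : Prop :=
  lact X t = ract t X.

(** Irreducibility in the form of Schur's lemma: the commutant is scalar. The empty matrix
    qualifies, so positivity of the size is demanded separately where it matters. *)
Definition irreducible_corep (K : comNzRingType) (V : lmodType K) n
    (t : 'I_n -> 'I_n -> V) : Prop :=
  forall X : 'M[K]_n, intertwines t X -> is_scalar_mx X.

Local Notation adj X := (map_mx Num.conj X^T).

(** * Reduction to irreducible unitary corepresentations *)

Section Reduction.
Variables (K : numClosedFieldType) (C : circCoalgType K).

Lemma circ_lact n (X : 'M[K]_n) (t : 'I_n -> 'I_n -> C) i j :
  circ (lact X t i j) = ract (fun k l => circ (t l k)) (adj X) j i.
Proof. by rewrite circ_sum; apply: eq_bigr => k _; rewrite circZ !mxE. Qed.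

Lemma circ_ract n (X : 'M[K]_n) (t : 'I_n -> 'I_n -> C) i j :
  circ (ract t X i j) = lact (adj X) (fun k l => circ (t l k)) j i.
Proof. by rewrite circ_sum; apply: eq_bigr => k _; rewrite circZ !mxE. Qed.

Variables (n : nat) (t : 'I_n -> 'I_n -> C).
Hypothesis tU : unitary_corep t.

Let circ_t : (fun k l => circ (t l k)) = t.
Proof. by case: tU => _ tC _; apply/funext => k; apply/funext => l. Qed.

(** Applying [circ] entrywise and transposing fixes [t] and turns the left action of [X] into the
    right action of its adjoint. *)
Lemma intertwines_adjoint X :
  intertwines t X -> intertwines t (adj X).
Proof.
move=> tX; apply/funext => i; apply/funext => j.
by rewrite -{1}circ_t -{2}circ_t -circ_lact -circ_ract tX.
Qed.

Lemma intertwines_comb a b X Y :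
  intertwines t X -> intertwines t Y -> intertwines t (a *: X + b *: Y).
Proof.
move=> tX tY; apply/funext => i; apply/funext => j.
by rewrite lactD ractD !lactZ !ractZ tX tY.
Qed.

(** Unitarity of [P] enters twice: [Q] is the inverse of [P] for the coproduct and the counit, and
    its adjoint for [circ]. *)
Lemma unitary_corep_conj (P : 'M[K]_n) :
  P \is unitarymx -> unitary_corep (ract (lact P t) (adj P)).
Proof.
move=> PU; set Q := (adj P).
have PQ : P *m Q = 1%:M by apply/eqP; move: PU; rewrite qualifE.
have QP : Q *m P = 1%:M by apply: mulmx1C.
have QT : adj Q = P by exact: trmxCK.
case: tU => tM tC te; split.
- move=> i j; rewrite tens_ract_lact.
  transitivity (\sum_k lact P t i k ⊗ ract t Q k j); last first.
    apply: eq_bigr => k _; congr (_ ⊗ _).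
    by rewrite -lact_ract -/(lact Q _ k j) -lactM QP lact1.
  rewrite /ract comul_sum.
  transitivity (\sum_l \sum_k lact P t i k ⊗ (Q l j *: t k l)); last first.
    by rewrite exchange_big; apply: eq_bigr => k _; rewrite -tens_sumr.
  apply: eq_bigr => l _; rewrite comulZ comul_sum.
  transitivity (Q l j *: \sum_m P i m *: \sum_k t m k ⊗ t k l).
    by congr (_ *: _); apply: eq_bigr => m _; rewrite comulZ tM.
  rewrite scaler_sumr.
  transitivity (\sum_m \sum_k (P i m *: t m k) ⊗ (Q l j *: t k l)).
    apply: eq_bigr => m _; rewrite !scaler_sumr; apply: eq_bigr => k _.
    by rewrite tensZl tensZr !scalerA mulrC.
  by rewrite exchange_big; apply: eq_bigr => k _; rewrite -tens_suml.
- move=> i j; rewrite circ_ract QT -[RHS]/(ract (lact P t) Q j i) -lact_ract.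
  congr (lact P _ j i); apply/funext => k; apply/funext => l.
  by rewrite circ_lact circ_t.
- move=> i j; have -> : ((i == j)%:R : K) = (P *m Q) i j by rewrite PQ mxE.
  rewrite mxE counit_sum; apply: eq_bigr => k _ /=.
  rewrite counitZ mulrC; congr (_ * _); rewrite counit_sum (bigD1 k)//=.
  rewrite counitZ te eqxx mulr1 big1 ?addr0// => l lk.
  by rewrite counitZ te (negPf lk) mulr0.
Qed.

(** If every hermitian intertwiner were scalar, then so would be [X + adj X] and
    ['i *: (X - adj X)], and [X] is a combination of these two. *)
Lemma reducible_hermitian :
  ~ irreducible_corep t ->
  exists H : 'M[K]_n,
    [/\ H \is hermsymmx, intertwines t H & ~~ is_scalar_mx H].
Proof.
move=> /existsNP[X /not_implyP[tX /negP Xs]].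
have tXa := intertwines_adjoint tX.
apply: contrapT => /forallNP noH.
have Hs H : H \is hermsymmx -> intertwines t H -> is_scalar_mx H.
  by move=> HH tH; apply: contrapT => /negP Hs; apply: (noH H).
have [a aE] : exists a, 1 *: X + 1 *: (adj X) = a%:M.
  apply/is_scalar_mxP/Hs/intertwines_comb => //.
  apply/is_hermitianmxP; rewrite expr0 !scale1r.
  by apply/matrixP => i j; rewrite !mxE rmorphD /= conjCK addrC.
have [b bE] : exists b, 'i *: X + (- 'i) *: (adj X) = b%:M.
  apply/is_scalar_mxP/Hs/intertwines_comb => //.
  apply/is_hermitianmxP; rewrite expr0 !scale1r.
  apply/matrixP => i j; rewrite !mxE rmorphD !rmorphM rmorphN /= conjCK conjCi.
  by rewrite opprK addrC.
case/negP: Xs; apply/is_scalar_mxP; exists (2^-1 * (a - 'i * b)).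
have -> : X = 2^-1 *: (a%:M - 'i *: b%:M).
  rewrite -aE -bE; apply/matrixP => i j; rewrite !mxE.
  set x := X i j; set y := (X j i)^*.
  have -> : 'i * ('i * x + - 'i * y) = 'i ^+ 2 * (x - y) :> K by ring.
  by rewrite sqrCi; field.
by rewrite scale_scalar_mx -raddfB scale_scalar_mx.
Qed.

End Reduction.

Section ReductionInduction.
Variables (K : numClosedFieldType) (C : circCoalgType K).

(** In the coproduct of a block entry, an intermediate index outside [S] contributes a zero left
    leg. *)
Lemma unitary_corep_block n (t : 'I_n -> 'I_n -> C) (S : {pred 'I_n}) :
  unitary_corep t -> (forall i j, i \in S -> j \notin S -> t i j = 0) ->
  unitary_corep (fun i j : 'I_#|S| => t (enum_val i) (enum_val j)).
Proof.
move=> [tM tC te] tS; split=> [i j|i j|i j]; rewrite ?tC ?te//.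
- rewrite tM (bigID (mem S))/= [X in _ + X]big1 ?addr0.
    by rewrite (big_enum_val (fun k => t (enum_val i) k ⊗ t k (enum_val j))).
  by move=> k kS; rewrite tS ?enum_valP// -[0](scale0r (0 : C)) tensZl scale0r.
- by rewrite (inj_eq enum_val_inj).
Qed.

Lemma irreducible_ind (P : C -> Prop) :
  lin_closed P ->
  (forall n (t : 'I_n -> 'I_n -> C),
     unitary_corep t -> irreducible_corep t -> forall i j, P (t i j)) ->
  forall n (t : 'I_n -> 'I_n -> C), unitary_corep t -> forall i j, P (t i j).
Proof.
move=> Pl Pirr; elim/ltn_ind => n IHn t tU.
have [|/(reducible_hermitian tU)[H [HH tH Hns]] i0 j0] := pselect (irreducible_corep t).
  exact: Pirr.
have /orthomx_spectralP := hermitian_normalmx HH.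
set U := spectralmx H; set d := spectral_diag H.
have UU : U \is unitarymx := spectral_unitarymx H.
have Uunit := spectral_unit H.
rewrite (invmx_unitary UU) => HE.
set Q : 'M_n := (map_mx _ U^T) in HE.
have UQ : U *m Q = 1%:M by apply/unitarymxP.
have QU : Q *m U = 1%:M by apply: mulmx1C.
(* [s] is [t] in an orthonormal eigenbasis of [H]; the entries of [t] are linear combinations of
   those of [s], so it is enough to treat [s]. *)
pose s := ract (lact U t) Q.
have sU : unitary_corep s by apply: unitary_corep_conj.
have ts : t = ract (lact Q s) U.
  by rewrite /s lact_ract -ractM -lactM QU lact1 ract1.
have sd : lact (diag_mx d) s = ract s (diag_mx d).
  have DH : diag_mx d *m U = U *m H by rewrite HE !mulmxA UQ mul1mx.
  have HD : H *m Q = Q *m diag_mx d by rewrite HE -!mulmxA UQ mulmx1.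
  by rewrite /s lact_ract -lactM DH lactM tH lact_ract -!ractM HD.
(* Commuting with a diagonal matrix kills the entries between different eigenvalues. *)
have s0 i j : d 0 i != d 0 j -> s i j = 0.
  move=> dij; have := congr1 (fun f => f i j) sd.
  rewrite lact_diag ract_diag => /eqP; rewrite -subr_eq0 -scalerBl scaler_eq0.
  by rewrite subr_eq0 (negPf dij) => /eqP.
suff Ps i j : P (s i j).
  rewrite ts; apply: lin_closed_sum => // k _.
  exact: lin_closed_sum.
pose S := [pred k | d 0 k == d 0 i].
have iS : i \in S by rewrite inE.
have [dij|/s0->] := eqVneq (d 0 i) (d 0 j); last first.
  exact: Pl.1.
have jS : j \in S by rewrite inE dij.
(* An eigenvalue block filling all indices would make [d] constant and therefore [H] scalar. *)
have Slt : (#|S| < n)%N.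
  rewrite -[n in (_ < n)%N]card_ord; apply: proper_card; rewrite properE subset_predT.
  apply/negP => /fintype.subsetP ST; case/negP: Hns; apply/is_scalar_mxP; exists (d 0 i).
  have -> : H = Q *m (d 0 i)%:M *m U.
    rewrite HE; congr (_ *m _ *m _); apply/matrixP => k l; rewrite !mxE.
    by have /eqP-> := ST k isT.
  by rewrite mul_mx_scalar -scalemxAl QU scalemx1.
have sS k l : k \in S -> l \notin S -> s k l = 0.
  rewrite !inE => /eqP kS lS; apply: s0; rewrite kS eq_sym.
  by [].
have := IHn _ Slt _ (unitary_corep_block sU sS) (enum_rank_in iS i) (enum_rank_in iS j).
by rewrite !enum_rankK_in.
Qed.

End ReductionInduction.

(** * Schur orthogonality *)

Lemma submod_closed_lin (K : pzRingType) (V : lmodType K) (D : set V) :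
  submod_closed (mem D) <-> lin_closed D.
Proof.
split=> [[D0 Dl]|[D0 Dl]]; split.
- by have := D0; rewrite inE.
- by move=> a x y Dx Dy; have := Dl a x y; rewrite !inE; apply.
- by rewrite inE.
- by move=> a x y; rewrite !inE => Dx Dy; apply: Dl.
Qed.

Lemma tensor_of_sets_lin (K : comNzRingType) (V W : lmodType K)
    (D : set V) (E : set W) :
  lin_closed D -> lin_closed (tensor_of_sets D E).
Proof.
move=> Dl; split=> [|a x y [s sDE ->] [s' sDE' ->]].
  by exists [::] => //; rewrite big_nil.
exists ([seq (a *: p.1, p.2) | p <- s] ++ s').
  move=> p; rewrite mem_cat => /orP[/mapP[q qs ->]|/sDE'//] /=.
  have [Dq Eq] := sDE q qs; split=> //.
  by rewrite -[a *: _]addr0; apply: Dl.2 Dl.1.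
rewrite big_cat big_map; congr (_ + _); rewrite scaler_sumr.
by apply: eq_bigr => p _ /=; rewrite tensZl.
Qed.

Lemma tsum_tensor_of_sets (K : comNzRingType) (V W U : lmodType K)
    (D : set V) (E : set W) (F : U -> Prop) (b : V -> W -> U) t :
  balanced b -> lin_closed F -> (forall x y, D x -> E y -> F (b x y)) ->
  tensor_of_sets D E t -> F (tensor_sum b t).
Proof.
move=> bP Fl Fb [s sDE ->]; rewrite tsum_sum_tens//.
elim: s sDE => [|p s IHs] sDE; first by rewrite big_nil; apply: Fl.1.
rewrite big_cons -[b _ _]scale1r; apply: Fl.2.
  by have [] := sDE p (mem_head _ _); apply: Fb.
by apply: IHs => q qs; apply: sDE; rewrite inE qs orbT.
Qed.

(** * Coefficient spaces of corepresentations *)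

Definition coef_span (K : pzRingType) (V : lmodType K) n
    (t : 'I_n -> 'I_n -> V) : set V :=
  [set c | exists a : 'M[K]_n, c = \sum_i \sum_j a i j *: t i j].

Section CoefSpan.
Variables (K : fieldType) (V : lmodType K) (n : nat) (t : 'I_n -> 'I_n -> V).

Lemma coef_span_lin : lin_closed (coef_span t).
Proof.
split=> [|c x y [a ->] [b ->]].
  by exists 0; rewrite big1// => i _; rewrite big1// => j _; rewrite mxE scale0r.
exists (c *: a + b); rewrite scaler_sumr -big_split; apply: eq_bigr => i _ /=.
rewrite scaler_sumr -big_split; apply: eq_bigr => j _ /=.
by rewrite !mxE scalerDl scalerA.
Qed.

Lemma sum_delta_mx i j : \sum_k \sum_l (delta_mx i j : 'M[K]_n) k l *: t k l = t i j.
Proof.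
rewrite (bigD1 i)//= (bigD1 j)//= mxE !eqxx scale1r.
rewrite big1 ?addr0 => [|l lj]; last by rewrite mxE (negPf lj) andbF scale0r.
rewrite big1 ?addr0// => k ki; rewrite big1// => l _.
by rewrite mxE (negPf ki) scale0r.
Qed.

Lemma coef_span_mem i j : coef_span t (t i j).
Proof. by exists (delta_mx i j); rewrite sum_delta_mx. Qed.

Lemma coef_span_min (P : V -> Prop) :
  lin_closed P -> (forall i j, P (t i j)) -> forall c, coef_span t c -> P c.
Proof.
move=> Pl Pt c [a ->].
rewrite (eq_bigr (fun i => 1 *: \sum_j a i j *: t i j)) => [|i _].
  by apply: lin_closed_sum => // i _; apply: lin_closed_sum.
by rewrite scale1r.
Qed.

End CoefSpan.

Section Schur.
Variables (K : numClosedFieldType) (C : circCoalgType K).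
Variables (ip : {dot C for Num.conj}).
Hypothesis uip : Defs.is_unitary comul ip.

Lemma subcoalgebra_lslice (E : set C) v x :
  is_subcoalgebra E -> E x -> E (lslice ip v x).
Proof.
move=> [/submod_closed_lin El Ecomul] Ex.
apply: (tsum_tensor_of_sets (lslice_balanced ip v) El _ (Ecomul x Ex)) => y z _ Ez.
by rewrite -[_ *: _]addr0; apply: El.2 El.1.
Qed.

Lemma subcoalgebra_rslice (E : set C) v x :
  is_subcoalgebra E -> E x -> E (rslice ip v x).
Proof.
move=> [/submod_closed_lin El Ecomul] Ex.
apply: (tsum_tensor_of_sets (rslice_balanced ip v) El _ (Ecomul x Ex)) => y z Ey _.
by rewrite -[_ *: _]addr0; apply: El.2 El.1.
Qed.

Lemma lslice_sum v (I : Type) (r : seq I) (P : pred I) (F : I -> C) :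
  lslice ip v (\sum_(i <- r | P i) F i) = \sum_(i <- r | P i) lslice ip v (F i).
Proof.
apply: big_morph; first exact: lsliceD.
by apply: (addIr (lslice ip v 0)); rewrite -lsliceD !add0r.
Qed.

Lemma rslice_sum v (I : Type) (r : seq I) (P : pred I) (F : I -> C) :
  rslice ip v (\sum_(i <- r | P i) F i) = \sum_(i <- r | P i) rslice ip v (F i).
Proof.
apply: big_morph; first exact: rsliceD.
by apply: (addIr (rslice ip v 0)); rewrite -rsliceD !add0r.
Qed.

Section Corep.
Variables (n : nat) (t : 'I_n -> 'I_n -> C).
Hypotheses (tU : unitary_corep t) (tirr : irreducible_corep t).

Let lslice_t v i j : lslice ip v (t i j) = \sum_k ip (t i k) v *: t k j.
Proof.
by case: tU => tM _ _; rewrite /lslice tM tsum_sum_tens//; apply: lslice_balanced.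
Qed.

Let rslice_t v i j : rslice ip v (t i j) = \sum_k ip (t k j) v *: t i k.
Proof.
by case: tU => tM _ _; rewrite /rslice tM tsum_sum_tens//; apply: rslice_balanced.
Qed.

(* By unitarity the matrix of inner products [ip (t k m) (t i j)], with [k] and
   [i] fixed, intertwines [t] with itself. *)
Lemma schur_orthogonality :
  exists L : 'M[K]_n, forall k m i j, ip (t k m) (t i j) = (j == m)%:R * L k i.
Proof.
have /choice[L LE] (p : 'I_n * 'I_n) :
    exists a, forall j m, ip (t p.1 m) (t p.2 j) = (j == m)%:R * a.
  case: p => k i /=.
  pose X := \matrix_(j, m) ip (t k m) (t i j).
  suff /tirr/is_scalar_mxP[a Xa] : intertwines t X.
    exists a => j m; have := congr1 (fun Y : 'M_n => Y j m) Xa.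
    by rewrite !mxE => ->; rewrite mulr_natl.
  apply/funext => j; apply/funext => l.
  transitivity (lslice ip (t i j) (t k l)).
    by rewrite lslice_t; apply: eq_bigr => m _; rewrite mxE.
  case: tU => tM tC _; rewrite /lslice uip tM tsum_sum_tens.
    by apply: eq_bigr => m _; rewrite mxE tC.
  apply: (balanced_scalel Num.conj); last exact: circZ.
  - exact: dotDr.
  - exact: circD.
  - by move=> a x; rewrite dotZr.
by exists (\matrix_(k, i) L (k, i)) => k m i j; rewrite mxE (LE (k, i)).
Qed.

(** The matrix [L] of the orthogonality relations is invertible: a row vector [x] in its left kernel
    makes [c], the combination of column [j] of [t] with coefficients [x], a vector of norm zero,
    while the counit of [c] is the entry [j] of [x]. *)
Lemma dual_coefficients :
  exists y : 'I_n -> 'I_n -> C, forall p r i j,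
    ip (t i j) (y p r) = ((i == p) && (j == r))%:R.
Proof.
have [L LE] := schur_orthogonality.
have [_ _ te] := tU.
have Lunit : L \in unitmx.
  rewrite -row_free_unit; apply: inj_row_free => x xL.
  apply/rowP => j; rewrite [RHS]mxE.
  pose c := \sum_k x 0 k *: t k j.
  have c0 : c = 0.
    apply/eqP; apply: contraT => c0; have := @neq0_dnorm_gt0 _ _ _ ip c c0.
    rewrite {1}/c dot_suml.
    suff -> : \sum_k ip (x 0 k *: t k j) c = \sum_i (x *m L) 0 i * (x 0 i)^*.
      by rewrite xL big1 ?ltxx// => i _; rewrite mxE mul0r.
    transitivity (\sum_k \sum_i x 0 k * L k i * (x 0 i)^*).
      apply: eq_bigr => k _; rewrite dotC /c dot_suml rmorph_sum.
      apply: eq_bigr => i _ /=; rewrite -dotC dotZl dotZr LE eqxx mul1r.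
      by rewrite mulrA mulrAC.
    rewrite exchange_big; apply: eq_bigr => i _ /=.
    by rewrite mxE mulr_suml.
  have := congr1 counit c0; rewrite linear0 /c counit_sum (bigD1 j)//= counitZ te.
  rewrite eqxx mulr1 big1 ?addr0// => k kj.
  by rewrite counitZ te (negPf kj) mulr0.
(* The conjugate compensates for conjugate linearity in the second argument of [ip], so that the
   pairing produces [L *m invmx L]. *)
exists (fun p r => \sum_k (invmx L k p)^* *: t k r) => p r i j.
rewrite dotC dot_suml rmorph_sum.
transitivity ((j == r)%:R * (L *m invmx L) i p).
  rewrite mxE mulr_sumr; apply: eq_bigr => k _ /=.
  by rewrite -dotC dotZr conjCK LE eq_sym mulrCA mulrA mulrAC mulrA.
by rewrite mulmxV// mxE -natrM mulnb andbC.
Qed.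

Lemma coef_uniq (a b : 'M[K]_n) :
  \sum_i \sum_j a i j *: t i j = \sum_i \sum_j b i j *: t i j -> a = b.
Proof.
have [y yE] := dual_coefficients.
have coefE (c : 'M[K]_n) p r : ip (\sum_i \sum_j c i j *: t i j) (y p r) = c p r.
  rewrite dot_suml (bigD1 p)//= dot_suml (bigD1 r)//= dotZl yE !eqxx mulr1.
  rewrite big1 => [|j jr]; last by rewrite dotZl yE (negPf jr) andbF mulr0.
  rewrite big1 ?addr0// => i ip'; rewrite dot_suml big1// => j _.
  by rewrite dotZl yE (negPf ip') mulr0.
by move=> ab; apply/matrixP => p r; rewrite -coefE ab coefE.
Qed.

Lemma coef_span_subcoalgebra : is_subcoalgebra (coef_span t).
Proof.
split; first exact/submod_closed_lin/coef_span_lin.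
pose P c := tensor_of_sets (coef_span t) (coef_span t) (comul c).
apply: (@coef_span_min _ _ _ _ P).
  have [T0 Tl] := @tensor_of_sets_lin _ _ _ (coef_span t) (coef_span t) (coef_span_lin t).
  by split=> [|a x y]; rewrite /P ?linear0// linearP; apply: Tl.
case: tU => tM _ _ i j; rewrite /P tM.
exists [seq (t i k, t k j) | k <- enum 'I_n].
  by move=> _ /mapP[k _ ->]; split; apply: coef_span_mem.
by rewrite big_map big_enum.
Qed.

Lemma coef_span_circ c : coef_span t c -> coef_span t (circ c).
Proof.
case: tU => _ tC _ [a ->]; exists (map_mx Num.conj a^T).
rewrite circ_sum exchange_big; apply: eq_bigr => i _ /=.
by rewrite circ_sum; apply: eq_bigr => j _; rewrite circZ tC !mxE.
Qed.

(* Two-sided slicing against the dual elements isolates one coefficient. *)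
Lemma coef_span_sub (E : set C) c :
  is_subcoalgebra E -> coef_span t c -> E c -> c != 0 -> coef_span t `<=` E.
Proof.
move=> Esub [a cE] Ec c0.
have [y yE] := dual_coefficients.
have /submod_closed_lin El := Esub.1.
have [p [q apq]] : exists p q, a p q != 0.
  apply: contrapT => /forallNP a0; case/negP: c0; apply/eqP; rewrite cE.
  rewrite big1// => i _; rewrite big1// => j _.
  have /forallNP/(_ j)/negP := a0 i; rewrite negbK => /eqP->.
  by rewrite scale0r.
move=> d; apply: coef_span_min => // r s.
have lE : lslice ip (y p r) c = \sum_j a p j *: t r j.
  rewrite cE lslice_sum (bigD1 p)//= [X in _ + X]big1 ?addr0 => [|i ip'].
    rewrite lslice_sum; apply: eq_bigr => j _; rewrite lsliceZ lslice_t.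
    rewrite (bigD1 r)//= yE !eqxx scale1r big1 ?addr0// => k kr.
    by rewrite yE (negPf kr) andbF scale0r.
  rewrite lslice_sum big1// => j _; rewrite lsliceZ lslice_t big1 ?scaler0// => k _.
  by rewrite yE (negPf ip') scale0r.
have rE : rslice ip (y s q) (lslice ip (y p r) c) = a p q *: t r s.
  rewrite lE rslice_sum (bigD1 q)//= [X in _ + X]big1 ?addr0 => [|j jq].
    rewrite rsliceZ rslice_t (bigD1 s)//= yE !eqxx scale1r big1 ?addr0// => k ks.
    by rewrite yE (negPf ks) scale0r.
  rewrite rsliceZ rslice_t big1 ?scaler0// => k _.
  by rewrite yE (negPf jq) andbF scale0r.
have := subcoalgebra_rslice (y s q) Esub (subcoalgebra_lslice (y p r) Esub Ec).
rewrite rE => Ets; rewrite -[t r s](scalerK apq) -[_ *: _]addr0.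
exact: El.2 El.1.
Qed.

(** A diagonal entry has counit 1, so a positive size makes the space nonzero. A subcoalgebra inside
    it with a nonzero element is everything by [coef_span_sub]. *)
Lemma coef_span_simple : (0 < n)%N -> is_simple_circ_subcoalgebra (coef_span t).
Proof.
move=> n_gt0; have [_ _ te] := tU.
split; last first.
  rewrite eqEsubset; split=> [_ [c tc <-]|c tc]; first exact: coef_span_circ.
  by exists (circ c); [exact: coef_span_circ | exact: circ_circ].
split; first exact: coef_span_subcoalgebra.
  apply/eqP => D0; pose i := Ordinal n_gt0.
  have : coef_span t (t i i) by exact: coef_span_mem.
  rewrite D0 => /(congr1 counit); rewrite linear0 te eqxx => /eqP.
  by rewrite oner_eq0.
move=> E Esub EC; have [[c [Ec c0]]|noE] := pselect (exists c, E c /\ c != 0).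
  right; rewrite eqEsubset; split=> //.
  exact: (coef_span_sub Esub (EC c Ec) Ec c0).
left; rewrite eqEsubset; split=> [c Ec|_ ->].
  by apply/eqP; apply: contrapT => /negP c0; apply: noE; exists c.
by have /submod_closed_lin[] := Esub.1.
Qed.

Lemma coef_span_basis : is_unitary_matrix_basis (coef_span t) t.
Proof.
case: (tU) => tM tC _; split=> //; split; first exact: coef_span_mem.
by move=> v [a vE]; exists a; split=> // b vb; apply: coef_uniq; rewrite -vE.
Qed.

End Corep.
End Schur.

(** * Decomposition into simple subcoalgebras *)

(** The set [A] may exceed the support of [F], so that several families can be summed over one
    common list. *)
Lemma fsum_fset_set (M : nmodType) (I : choiceType) (A : set I) (F : I -> M) :
  finite_set A -> (forall i, ~ A i -> F i = 0) ->
  \sum_(i \in [set: I]) F i = \sum_(i <- fset_set A) F i.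
Proof.
move=> Afin FA; apply: fsbigTE => i.
by rewrite in_fset_set// => /negP iA; apply: FA => Ai; apply: iA; exact: mem_set.
Qed.

Lemma fsumD (M : nmodType) (I : choiceType) (F G : I -> M) :
  finite_set [set i | F i != 0] -> finite_set [set i | G i != 0] ->
  \sum_(i \in [set: I]) (F i + G i)
  = \sum_(i \in [set: I]) F i + \sum_(i \in [set: I]) G i.
Proof.
move=> Ffin Gfin.
pose A := [set i | F i != 0] `|` [set i | G i != 0].
have Afin : finite_set A by rewrite finite_setU.
have AF i : ~ A i -> F i = 0 by move=> /not_orP[/negP + _]; rewrite negbK => /eqP.
have AG i : ~ A i -> G i = 0 by move=> /not_orP[_ /negP]; rewrite negbK => /eqP.
rewrite !(fsum_fset_set Afin)// -?big_split// => i iA.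
by rewrite AF// AG// addr0.
Qed.

Lemma fsum_morph (M N : nmodType) (I : choiceType) (g : M -> N) (F : I -> M) :
  g 0 = 0 -> {morph g : x y / x + y} -> finite_set [set i | F i != 0] ->
  g (\sum_(i \in [set: I]) F i) = \sum_(i \in [set: I]) g (F i).
Proof.
move=> g0 gD Ffin; have F0 i : ~ [set i | F i != 0] i -> F i = 0.
  by move=> /negP; rewrite negbK => /eqP.
rewrite !(fsum_fset_set Ffin)//; first exact: big_morph.
by move=> i /F0 ->.
Qed.

Lemma fsum_single (M : nmodType) (I : choiceType) (F : I -> M) i :
  (forall j, j != i -> F j = 0) -> \sum_(j \in [set: I]) F j = F i.
Proof.
move=> Fi; rewrite -(@fsbig_widen _ _ _ _ [set i])// ?fsbig_set1//.
by move=> j /= [_ /eqP/Fi].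
Qed.

Section DirectSum.
Variables (K : fieldType) (V : lmodType K) (I : choiceType) (D : I -> set V).
Hypothesis D_lin : forall i, lin_closed (D i).

(** This is the condition under [exists!] in [is_direct_sum]. *)
Definition decomposes (v : V) (x : I -> V) : Prop :=
  [/\ forall i, D i (x i), finite_set [set i | x i != 0] &
      v = \sum_(i \in [set: I]) x i].

Lemma decomposes_lin a u v x y :
  decomposes u x -> decomposes v y ->
  decomposes (a *: u + v) (fun i => a *: x i + y i).
Proof.
move=> [xD xfin ->] [yD yfin ->].
have axfin : finite_set [set i | a *: x i != 0].
  apply: sub_finite_set xfin => i /=; apply: contra => /eqP ->.
  by rewrite scaler0.
split=> [i| |]; first exact: (D_lin i).2.
- apply: (@sub_finite_set _ _ ([set i | a *: x i != 0] `|` [set i | y i != 0])).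
    move=> i /= xyi; apply/orP; move: xyi; apply: contraNT.
    by rewrite negb_or !negbK => /andP[/eqP-> /eqP->]; rewrite addr0.
  by rewrite finite_setU.
- rewrite fsumD// -(fsum_morph (g := GRing.scale a))//.
    exact: scaler0.
  exact: scalerDr.
Qed.

Lemma decomposes_single i v :
  D i v -> decomposes v (fun j => if j == i then v else 0).
Proof.
move=> Dv; split=> [j| |].
- by case: eqP => [->//|_]; exact: (D_lin j).1.
- apply: (sub_finite_set _ (finite_set1 i)) => j /=.
  by case: (eqVneq j i) => // _; rewrite eqxx.
- by rewrite (fsum_single (i := i)) ?eqxx// => j /negPf->.
Qed.

End DirectSum.

Section Decomposition.
Variables (K : numClosedFieldType) (C : circCoalgType K).
Variables (ip : {dot C for Num.conj}).
Hypothesis uip : Defs.is_unitary comul ip.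

Definition irreducible_coef_space (D : set C) : Prop :=
  exists n (t : 'I_n -> 'I_n -> C),
    [/\ (0 < n)%N, unitary_corep t, irreducible_corep t & D = coef_span t].

Lemma dot_irreducible_coef_space (D E : set C) :
  irreducible_coef_space D -> irreducible_coef_space E -> D <> E ->
  forall x y, D x -> E y -> ip x y = 0.
Proof.
move=> [n [t [_ tU tirr ->]]] [m [s [_ sU sirr ->]]] DE x y Dx Ey.
have Dsub := coef_span_subcoalgebra tU; have Esub := coef_span_subcoalgebra sU.
have Dz := subcoalgebra_lslice ip y Dsub Dx.
have Ez : coef_span s (lslice ip y x).
  have /submod_closed_lin El := Esub.1.
  rewrite /lslice uip; apply: (tsum_tensor_of_sets _ El _ (Esub.2 y Ey)).
    apply: (balanced_scalel Num.conj); last exact: circZ.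
    - exact: dotDr.
    - exact: circD.
    - by move=> a z; rewrite dotZr.
  move=> y0 y1 _ Ey1; rewrite -[_ *: _]addr0; apply: El.2 El.1.
  exact: coef_span_circ.
(* A nonzero element common to both spans would make each of them contain the other. *)
have [z0|z0] := eqVneq (lslice ip y x) 0; last first.
  case: DE; rewrite eqEsubset; split.
    exact: (coef_span_sub uip tU tirr Esub Dz Ez z0).
  exact: (coef_span_sub uip sU sirr Dsub Ez Dz z0).
(* By the right counit law for [x], the counit of the slice is [ip x y]. *)
have := congr1 counit z0; rewrite linear0 => <-.
rewrite /lslice (tsum_morph (g := counit)); last exact: counitD.
rewrite -[x in LHS]counitr (tsum_morph (g := fun u => ip u y)); last first.
  by move=> u v; rewrite dotDl.
by apply: eq_tsum => u v; rewrite dotZl counitZ mulrC.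
Qed.

(** Indexing by the spaces themselves, and not by corepresentations, ensures that distinct indices
    carry distinct, hence orthogonal, spaces. *)
Let I : choiceType := {classic {D : set C | irreducible_coef_space D}}.
Let D (i : I) : set C := sval i.

Let D_lin i : lin_closed (D i).
Proof.
by have [n [t [_ _ _]]] := svalP i; rewrite /D => ->; apply: coef_span_lin.
Qed.

Let D_orth i j x y : i <> j -> D i x -> D j y -> ip x y = 0.
Proof.
move=> ij; apply: dot_irreducible_coef_space; [exact: svalP|exact: svalP|].
by case: i j ij => [E Ei] [F Fi] ij /= EF; apply: ij; apply: eq_exist.
Qed.

(** Existence: the decomposable vectors form a linear subspace containing all entries of irreducible
    unitary corepresentations. Uniqueness: by orthogonality, pairing with an element of [D i] sees
    only the component at [i]. *)
Lemma irreducible_coef_space_decomposition :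
  exists (I : choiceType) (D : I -> set C),
    is_direct_sum D /\ forall i, irreducible_coef_space (D i).
Proof.
exists I, D; split; last by move=> i; apply: svalP.
split=> [i|v]; first exact/submod_closed_lin/D_lin.
have decE u x w i : decomposes D u x -> D i w -> ip u w = ip (x i) w.
  move=> [xD xfin ->] Dw.
  rewrite (@fsum_fset_set _ _ [set j | x j != 0])//; last first.
    by move=> j /negP; rewrite negbK => /eqP.
  rewrite dot_suml; have [xi0|xi0] := eqVneq (x i) 0.
    rewrite [x i]xi0 -[0 in RHS](scale0r (0 : C)) dotZl mul0r big1_seq// => j _.
    have [->|/eqP ji] := eqVneq j i.
      by rewrite xi0 -[0](scale0r (0 : C)) dotZl mul0r.
    exact: D_orth ji (xD j) Dw.
  rewrite (bigD1_seq i)//=; last by rewrite in_fset_set// inE.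
  rewrite big1 ?addr0// => j /eqP ji.
  exact: D_orth ji (xD j) Dw.
pose P u := exists x, decomposes D u x.
have P_lin : lin_closed P.
  split=> [|a u w [x ux] [y wy]]; last first.
    by exists (fun i => a *: x i + y i); apply: decomposes_lin.
  exists (fun=> 0); split=> [i| |]; first exact: (D_lin i).1.
    by rewrite (_ : [set _ | _] = set0)//; apply/seteqP; split=> i //=; rewrite eqxx.
  by rewrite fsbig1.
have [x xv] : exists x, decomposes D v x.
  apply: (unitary_corep_ind uip P_lin); apply: (irreducible_ind P_lin).
  move=> n t tU tirr i j.
  have tsp : irreducible_coef_space (coef_span t).
    exists n, t; split=> //; exact: leq_ltn_trans (ltn_ord i).
  pose k : I := exist _ _ tsp.
  by eexists; apply: (decomposes_single D_lin (i := k)); apply: coef_span_mem.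
exists x; split=> // y yv; apply/funext => i.
(* The difference of two components at [i] lies in [D i]; by [decE] its pairing with itself is
   zero. *)
apply/eqP; rewrite -subr_eq0; apply: contraT => xy0.
have Dw : D i (x i - y i).
  rewrite addrC -scaleN1r; apply: (D_lin i).2; [by case: yv|by case: xv].
have := @neq0_dnorm_gt0 _ _ _ ip _ xy0.
by rewrite {1}[x i - y i]lock -lock dotBl -(decE v x)// -(decE v y)// subrr ltxx.
Qed.

End Decomposition.

(** * Existence of inner products *)

Section HamelBasis.
Variables (K : fieldType) (V : lmodType K).

(** Linear combinations are encoded by finitely supported functions on [V], with the vectors serving
    as their own indices. *)
Let finsupp (A : set V) (f : V -> K) : Prop :=
  finite_set [set x | f x != 0] /\ [set x | f x != 0] `<=` A.

Let comb (f : V -> K) : V := \sum_(x \in [set: V]) f x *: x.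

Let fin_comb f : finite_set [set x | f x != 0] ->
  finite_set [set x : V | f x *: x != 0].
Proof.
apply: sub_finite_set => x /=; apply: contra => /eqP ->.
by rewrite scale0r.
Qed.

Let finsupp_lin A a f g : finsupp A f -> finsupp A g ->
  finsupp A (fun x => a * f x + g x).
Proof.
move=> [ffin fA] [gfin gA].
have sub : [set x | a * f x + g x != 0] `<=` [set x | f x != 0] `|` [set x | g x != 0].
  move=> x /= afg; apply/orP; move: afg; apply: contraNT.
  by rewrite negb_or !negbK => /andP[/eqP-> /eqP->]; rewrite mulr0 addr0.
split; first by apply: sub_finite_set sub _; rewrite finite_setU.
by move=> x /sub[/fA|/gA].
Qed.

Let comb_lin A a f g : finsupp A f -> finsupp A g ->
  comb (fun x => a * f x + g x) = a *: comb f + comb g.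
Proof.
move=> [ffin fA] [gfin gA].
rewrite /comb (fsum_morph (g := GRing.scale a)); last exact: fin_comb.
- rewrite -fsumD; last exact: fin_comb.
    by apply: eq_fsbigr => x _; rewrite scalerDl scalerA.
  apply: sub_finite_set ffin => x /=; apply: contra => /eqP ->.
  by rewrite scale0r scaler0.
- exact: scaler0.
- exact: scalerDr.
Qed.

Let independent (A : set V) : Prop :=
  forall f, finsupp A f -> comb f = 0 -> forall x, f x = 0.

(** A finite list in the union of a chain lies in a single member. The alternative [s = [::]] covers
    the empty chain. *)
Let chain_bound (F : set (set V)) (s : seq V) :
  total_on F subset -> {in s, forall x, (\bigcup_(X in F) X) x} ->
  s = [::] \/ exists2 X, F X & {in s, forall x, X x}.
Proof.
move=> Ftot; elim: s => [|x s IHs] sF; [by left|right].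
have [X FX Xx] := sF x (mem_head _ _).
have [|->|[Y FY sY]] := IHs.
- by move=> y ys; apply: sF; rewrite inE ys orbT.
- by exists X => // y; rewrite inE => /eqP->.
- have [XY|YX] := Ftot X Y FX FY.
    by exists Y => // y; rewrite inE => /predU1P[->|/sY//]; apply: XY.
  by exists X => // y; rewrite inE => /predU1P[->//|/sY]; apply: YX.
Qed.

(** Zorn's lemma applies because a linear relation has finite support, so a relation in the union of
    a chain already holds in one member. *)
Let maximal_independent :
  exists A, independent A /\ forall B, A `<` B -> ~ independent B.
Proof.
apply: Zorn_bigcup => F Find Ftot f [ffin fF] f0 x.
have [|s0|[X FX sX]] := @chain_bound F (fset_set [set x | f x != 0]) Ftot.
- by move=> y; rewrite in_fset_set// inE => /fF.
- apply/eqP; apply: contraT => fx.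
  have : x \in (fset_set [set x | f x != 0] : seq V) by rewrite in_fset_set// inE.
  by rewrite s0.
- apply: (Find X FX f) => //; split=> // y fy.
  by apply: sX; rewrite in_fset_set// inE.
Qed.

Let single v : V -> K := fun x => (x == v)%:R.

Let single_finsupp (A : set V) v : A v -> finsupp A (single v).
Proof.
move=> Av; have sub : [set x | single v x != 0] `<=` [set v].
  by move=> x /=; rewrite /single; have [->//|_] := eqVneq x v; rewrite eqxx.
split; first exact: sub_finite_set sub (finite_set1 v).
by move=> x /sub ->.
Qed.

Let comb_single v : comb (single v) = v.
Proof.
rewrite /comb (fsum_single (i := v)) /single ?eqxx ?scale1r// => x /negPf->.
by rewrite scale0r.
Qed.

(* The [phi x] are the coordinates in a Hamel basis [A] of [V], and [phi x = 0]
   for [x] outside [A]. *)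
Lemma coordinate_system :
  exists phi : V -> V -> K,
    [/\ forall x, scalar (phi x),
        forall v, finite_set [set x | phi x v != 0] &
        forall v, (forall x, phi x v = 0) -> v = 0].
Proof.
have [A [Aind Amax]] := maximal_independent.
(* Otherwise adding [v] to [A] would preserve independence, against maximality. *)
have span v : exists f, finsupp A f /\ comb f = v.
  apply: contrapT => vA.
  have nAv : ~ A v.
    by move=> Av; apply: vA; exists (single v); split; [exact: single_finsupp|].
  apply: (Amax (v |` A)).
    by split=> [x Ax|vAA]; [right|apply: nAv; apply: vAA; left].
  move=> f [ffin fA] f0.
  have fv : f v = 0.
    apply/eqP; apply: contraT => fv; exfalso; apply: vA.
    have vv : (v |` A) v by left.
    have fAv : finsupp (v |` A) f by [].
    (* The relation [f] solved for [v]; adding [single v] cancels the coefficient at [v], so the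
       support falls back into [A]. *)
    exists (fun x => - (f v)^-1 * f x + single v x); split; last first.
      by rewrite (comb_lin _ fAv (single_finsupp vv)) f0 scaler0 add0r comb_single.
    have [gfin gA] := finsupp_lin (- (f v)^-1) fAv (single_finsupp vv).
    split=> // x gx; case: (gA x gx) => // xv; move: gx => /=.
    by rewrite xv /single eqxx mulNr mulVf// addNr eqxx.
  apply: Aind => //; split=> // x fx; case: (fA x fx) => // xv.
  by move: fx; rewrite /= xv fv eqxx.
have [phi phiE] := choice span.
have uniq v f : finsupp A f -> comb f = v -> phi v = f.
  move=> fA fv; have [pA pv] := phiE v.
  apply/funext => x; apply/eqP; rewrite -subr_eq0; apply/eqP.
  have := Aind _ (finsupp_lin (-1) fA pA); rewrite (comb_lin _ fA pA) fv pv.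
  by rewrite scaleN1r addNr => /(_ erefl x); rewrite mulN1r addrC.
exists (fun x v => phi v x); split=> [x a u v|v|v v0].
- have [uA uE] := phiE u; have [vA vE] := phiE v.
  rewrite (uniq _ (fun x => a * phi u x + phi v x))//; first exact: finsupp_lin.
  by rewrite (comb_lin _ uA vA) uE vE.
- by have [[]] := phiE v.
- have [_ <-] := phiE v; rewrite /comb fsbig1// => x _.
  by rewrite v0 scale0r.
Qed.

End HamelBasis.

(** The standard hermitian form in Hamel coordinates: the sums are finite by finite support, and
    definiteness holds because the coordinates separate vectors. *)
Lemma dot_product_exists (K : numClosedFieldType) (V : lmodType K) :
  inhabited {dot V for Num.conj}.
Proof.
have [phi [phil phifin phi0]] := coordinate_system V.
have fin u v : finite_set [set x | phi x u * (phi x v)^* != 0].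
  apply: sub_finite_set (phifin u) => x /=; apply: contra => /eqP ->.
  by rewrite mul0r.
have [|||ip _] := @dot_exists K V
  (fun u v => \sum_(x \in [set: V]) phi x u * (phi x v)^*); last by exists.
- move=> w a u v.
  rewrite (_ : a * _ = \sum_(x \in [set: V]) a * (phi x u * (phi x w)^*)); last first.
    by rewrite mulr_fsumr.
  rewrite -fsumD//; first by apply: eq_fsbigr => x _; rewrite phil mulrDl mulrA.
  apply: sub_finite_set (fin u w) => x /=; apply: contra => /eqP ->.
  by rewrite mulr0.
- move=> u v; rewrite (fsum_morph (g := Num.conj)) ?rmorph0//.
    by apply: eq_fsbigr => x _; rewrite rmorphM /= conjCK mulrC.
  exact: rmorphD.
- move=> v v0; rewrite lt_def fsumr_ge0 => [|x _]; last exact: mul_conjC_ge0.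
  rewrite andbT; apply: contra v0 => /eqP ip0; apply/eqP/phi0 => x.
  apply/eqP; apply: contraT => px; move: ip0.
  rewrite (fsum_fset_set (fin v v)) => [|y /negP]; last by rewrite negbK => /eqP.
  have xS : x \in (fset_set [set x | phi x v * (phi x v)^* != 0] : seq V).
    by rewrite in_fset_set// inE /= mul_conjC_eq0.
  move/eqP; rewrite psumr_eq0 => [/allP/(_ x xS)|y _]; last exact: mul_conjC_ge0.
  by rewrite /= mul_conjC_eq0 (negPf px).
Qed.

(** * Unitarization of comodules *)

Section Unitarization.
Variables (K : numClosedFieldType) (C : circCoalgType K) (I : choiceType).
Variables (n : I -> nat) (t : forall r, 'I_(n r) -> 'I_(n r) -> C).
(** [f r c] is the coordinate matrix, in the basis [t r], of the component of [c] at [r]. *)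
Variable f : forall r, C -> 'M[K]_(n r).
Arguments t : clear implicits.
Arguments f : clear implicits.
Hypothesis f_linear : forall r, linear (f r).
Hypothesis f_fin : forall c, finite_set [set r | f r c != 0].
Hypothesis f_sum : forall c,
  c = \sum_(r \in [set: I]) \sum_i \sum_j f r c i j *: t r i j.
Hypothesis f_t : forall r i j, f r (t r i j) = delta_mx i j.
Hypothesis f_t0 : forall r s i j, r != s -> f s (t r i j) = 0.
Hypothesis comul_t : forall r i j, comul (t r i j) = \sum_k t r i k ⊗ t r k j.
Hypothesis circ_t : forall r i j, circ (t r i j) = t r j i.

Let fD r i j c d : f r (c + d) i j = f r c i j + f r d i j.
Proof. by have := f_linear r 1 c d; rewrite !scale1r => ->; rewrite mxE. Qed.

Let f0 r : f r 0 = 0.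
Proof.
have := f_linear r 1 0 0; rewrite scale1r addr0 scale1r => f00.
by apply: (addIr (f r 0)); rewrite add0r -f00.
Qed.

Let fZ r i j a c : f r (a *: c) i j = a * f r c i j.
Proof.
by have := f_linear r a c 0; rewrite addr0 f0 addr0 => ->; rewrite mxE.
Qed.

Let t_ind (P : C -> Prop) : lin_closed P -> (forall r i j, P (t r i j)) ->
  forall c, P c.
Proof.
move=> Pl Pt c; rewrite [c]f_sum; apply: big_ind; first exact: Pl.1.
  by move=> x y Px Py; rewrite -[x]scale1r; apply: Pl.2.
move=> r _; apply: big_ind; first exact: Pl.1.
  by move=> x y Px Py; rewrite -[x]scale1r; apply: Pl.2.
by move=> i _; apply: lin_closed_sum.
Qed.

Let f_inj c : (forall r, f r c = 0) -> c = 0.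
Proof.
move=> fc; rewrite [c]f_sum fsbig1// => r _; rewrite big1// => i _.
by rewrite big1// => j _; rewrite fc mxE scale0r.
Qed.

Let f_circ r c i j : f r (circ c) i j = (f r c j i)^*.
Proof.
apply: (@t_ind (fun c => forall i j, f r (circ c) i j = (f r c j i)^*)) => {c i j}.
  split=> [i j|a x y IHx IHy i j].
    by rewrite linear0 f0 !mxE rmorph0.
  by rewrite circD circZ !fD !fZ IHx IHy rmorphD rmorphM.
move=> s k l i j; rewrite circ_t; have [sr|sr] := eqVneq s r.
  by subst s; rewrite !f_t !mxE conjC_nat andbC.
by rewrite !f_t0// !mxE rmorph0.
Qed.

(** Forced by the left counit law: compare the coordinates at [(j, j)] in the expansion of [t i j]
    as the sum of [counit (t i k) *: t k j]. *)
Let counit_t r i j : counit (t r i j) = (i == j)%:R.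
Proof.
have := counitl (t r i j); rewrite comul_t tsum_sum_tens; last first.
  by apply: (balanced_scalel id) => // [x y|a x]; rewrite ?counitD ?counitZ.
have fsumE (F : 'I_(n r) -> C) : f r (\sum_k F k) j j = \sum_k f r (F k) j j.
  apply: (big_morph (fun x => f r x j j)) => [x y|]; first exact: fD.
  by rewrite f0 mxE.
move=> /(congr1 (fun x => f r x j j)); rewrite fsumE (bigD1 j)//= fZ !f_t !mxE !eqxx.
rewrite mulr1 big1 => [|k kj]; last by rewrite fZ f_t mxE eq_sym (negPf kj) mulr0.
by rewrite addr0 andbT eq_sym.
Qed.

Let counit_f c : counit c = \sum_(r \in [set: I]) \tr (f r c).
Proof.
rewrite {1}[c]f_sum (fsum_morph (g := counit)) ?linear0//.
- apply: eq_fsbigr => r _; rewrite counit_sum; apply: eq_bigr => i _.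
  rewrite counit_sum (bigD1 i)//= counitZ counit_t eqxx mulr1 big1 ?addr0//.
  by move=> j ji; rewrite counitZ counit_t eq_sym (negPf ji) mulr0.
- exact: counitD.
- apply: sub_finite_set (f_fin c) => r /=; apply: contra => /eqP fc.
  by rewrite big1// => i _; rewrite big1// => j _; rewrite fc mxE scale0r.
Qed.

Let conv_balanced r s i j k l :
  balanced (fun c d : C => f r c i j * f s d k l).
Proof.
split=> [x y z|x y z|a x y]; rewrite ?fD ?mulrDl ?mulrDr// !fZ.
by rewrite mulrCA mulrA.
Qed.

(** Dually to the coproduct of the [t r i j], the coordinate functionals multiply under convolution
    like matrix units. *)
Let conv_f r i j k l c :
  \sweedler_(c1, c2 <- comul c) (f r c1 i j * f r c2 k l) = (j == k)%:R * f r c i l.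
Proof.
move: c; apply: t_ind.
  split=> [|a x y IHx IHy].
    by rewrite linear0 tsum0 ?f0 ?mxE ?mulr0//; apply: conv_balanced.
  rewrite linearP tsumD; last exact: conv_balanced.
  rewrite (tsum_scale (conv_balanced i j k l) (s := *%R a)) => [|u v|u v].
  - by rewrite IHx IHy fD fZ mulrDr mulrCA.
  - exact: mulrDr.
  - by rewrite fZ mulrA.
move=> s p q; rewrite comul_t tsum_sum_tens; last exact: conv_balanced.
have [sr|sr] := eqVneq s r; last first.
  by rewrite big1 ?f_t0// ?mxE ?mulr0// => m _; rewrite !f_t0// mxE mul0r.
subst s; rewrite (bigD1 j)//= !f_t !mxE eqxx andbT big1 ?addr0 => [|m mj].
  rewrite -!natrM [k == j]eq_sym.
  by case: (j == k); case: (i == p); case: (l == q).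
by rewrite f_t mxE eq_sym [j == m]eq_sym (negPf mj) andbF mul0r.
Qed.

Let conv_f0 r s i j k l c : r != s ->
  \sweedler_(c1, c2 <- comul c) (f r c1 i j * f s c2 k l) = 0.
Proof.
move=> rs; move: c; apply: t_ind.
  split=> [|a x y IHx IHy].
    by rewrite linear0 tsum0//; apply: conv_balanced.
  rewrite linearP tsumD; last exact: conv_balanced.
  rewrite (tsum_scale (conv_balanced i j k l) (s := *%R a)) => [|u v|u v].
  - by rewrite IHx IHy mulr0 addr0.
  - exact: mulrDr.
  - by rewrite fZ mulrA.
move=> u p q; rewrite comul_t tsum_sum_tens; last exact: conv_balanced.
rewrite big1// => m _; have [ur|ur] := eqVneq u r.
  by subst u; rewrite (f_t0 _ _ rs) mxE mulr0.
by rewrite (f_t0 _ _ ur) mxE mul0r.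
Qed.

Variables (V : lmodType K) (chi : {linear V -> (V ⊗ C)%type}).
Hypothesis chiP : is_comodule chi.

Let sl r i j (x : V ⊗ C) : V := \sweedler_(u, c <- x) (f r c i j *: u).
Arguments sl : clear implicits.

Let sl_balanced r i j : balanced (fun (u : V) (c : C) => f r c i j *: u).
Proof. by apply: (balanced_scaler id) => // [x y|a x]; rewrite ?fD ?fZ. Qed.

(* By coassociativity the [E r i j] form a system of matrix units acting on [V]. *)
Let E r i j (v : V) : V := sl r i j (chi v).
Arguments E : clear implicits.

Let ED r i j : {morph E r i j : x y / x + y}.
Proof. by move=> x y; rewrite /E /sl linearD tsumD//; apply: sl_balanced. Qed.

Let EZ r i j a v : E r i j (a *: v) = a *: E r i j v.
Proof.
rewrite /E /sl (_ : chi (a *: v) = a *: chi v); last exact: linearZ.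
apply: tsum_scale => [|x y|x c].
- exact: sl_balanced.
- exact: scalerDr.
- by rewrite !scalerA mulrC.
Qed.

(** Composition of the operators is convolution of the functionals, by coassociativity of [chi]. *)
Let E_E r s i j k l v : E r i j (E s k l v) =
  \sweedler_(u, c <- chi v)
     ((\sweedler_(c1, c2 <- comul c) (f r c1 i j * f s c2 k l)) *: u).
Proof.
rewrite [E s k l v]/E /sl (tsum_morph (g := E r i j)); last exact: ED.
transitivity (\sweedler_(x, c2 <- chi v) \sweedler_(u, c1 <- chi x)
                ((f r c1 i j * f s c2 k l) *: u)).
  apply: eq_tsum => x c2; rewrite EZ /E /sl.
  rewrite (tsum_morph (g := GRing.scale (f s c2 k l))); last exact: scalerDr.
  by apply: eq_tsum => u c1; rewrite scalerA mulrC.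
rewrite (coassoc chiP) => [|u|u u' c d|a u c d].
- apply: eq_tsum => u c.
  by rewrite (tsum_morph (g := fun a => a *: u))// => a b; rewrite scalerDl.
- split=> [c c' d|c d d'|a c d].
  + by rewrite fD mulrDl scalerDl.
  + by rewrite fD mulrDr scalerDl.
  + by rewrite !fZ mulrCA mulrA.
- by rewrite scalerDr.
- by rewrite fZ !scalerA; congr (_ *: _); ring.
Qed.

Let E_mul r i j k l v : E r i j (E r k l v) = (j == k)%:R *: E r i l v.
Proof.
rewrite E_E; under eq_tsum do rewrite conv_f -scalerA.
by rewrite -(tsum_morph (g := GRing.scale (j == k)%:R)) // => x y; rewrite scalerDr.
Qed.

Let E_mul0 r s i j k l v : r != s -> E r i j (E s k l v) = 0.
Proof.
move=> rs; rewrite E_E; under eq_tsum do rewrite conv_f0// scale0r.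
by rewrite /tensor_sum big1.
Qed.

Let nz r (x : V ⊗ C) : Prop := exists i j, sl r i j x != 0.

Let nzN r x i j : ~ nz r x -> sl r i j x = 0.
Proof.
by move=> /forallNP/(_ i)/forallNP/(_ j)/negP; rewrite negbK => /eqP.
Qed.

(** A pure tensor [u ⊗ c] meets only the finitely many blocks where [c] has a nonzero component. *)
Let sl_fin x : finite_set [set r | nz r x].
Proof.
elim/tensor_ind: x => [|x y xfin yfin|u c].
- rewrite (_ : [set _ | _] = set0)//; apply/seteqP; split=> r //= [i [j]].
  by rewrite /sl tsum0 ?eqxx//; apply: sl_balanced.
- apply: (@sub_finite_set _ _ ([set r | nz r x] `|` [set r | nz r y])).
    move=> r [i [j xy]]; apply: contrapT => /not_orP[/= /nzN xr /nzN yr].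
    move: xy; rewrite /sl tsumD; last exact: sl_balanced.
    by rewrite -/(sl _ _ _ _) -/(sl _ _ _ y) xr yr addr0 eqxx.
  by rewrite finite_setU.
- apply: sub_finite_set (f_fin c) => r [i [j]] /=; apply: contra => /eqP fc.
  by rewrite /sl tensor_sum_tens ?fc ?mxE ?scale0r//; apply: sl_balanced.
Qed.

Let tr_fin x : finite_set [set r | \sum_i sl r i i x != 0].
Proof.
apply: sub_finite_set (sl_fin x) => r /=; apply: contraNP => /nzN xr.
by rewrite big1 ?eqxx// => i _; apply: xr.
Qed.

(** The counit is the sum of the traces of the blocks. The general tensor [x] allows induction; at
    [chi v] the identity says that the diagonal units [E r i i] sum to the identity of [V]. *)
Let counit_sl x : \sweedler_(u, c <- x) (counit c *: u)
                  = \sum_(r \in [set: I]) \sum_i sl r i i x.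
Proof.
have cB : balanced (fun (u : V) (c : C) => counit c *: u).
  by apply: (balanced_scaler id) => // [y z|a y]; rewrite ?counitD ?counitZ.
elim/tensor_ind: x => [|x y xE yE|u c].
- rewrite tsum0// fsbig1// => r _; rewrite big1// => i _.
  by rewrite /sl tsum0//; apply: sl_balanced.
- rewrite tsumD// xE yE -fsumD; [|exact: tr_fin|exact: tr_fin].
  apply: eq_fsbigr => r _; rewrite -big_split; apply: eq_bigr => i _ /=.
  by rewrite /sl tsumD//; apply: sl_balanced.
- rewrite tensor_sum_tens// counit_f (fsum_morph (g := fun a => a *: u)).
  + apply: eq_fsbigr => r _; rewrite scaler_suml; apply: eq_bigr => i _.
    by rewrite /sl tensor_sum_tens//; apply: sl_balanced.
  + exact: scale0r.
  + by move=> a b; rewrite scalerDl.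
  + apply: sub_finite_set (f_fin c) => r /=; apply: contra => /eqP ->.
    by rewrite mxtrace0.
Qed.

Let E_inj v : (forall r i j, E r i j v = 0) -> v = 0.
Proof.
move=> Ev; rewrite -[v]chiP.2 counit_sl fsbig1// => r _.
by rewrite big1// => i _; apply: Ev.
Qed.

Lemma unitarizable : admits_unitary_inner_product chi.
Proof.
have [ip0] := dot_product_exists V.
pose F u v r := \sum_i \sum_j ip0 (E r i j u) (E r i j v).
have F_fin u v : finite_set [set r | F u v r != 0].
  apply: sub_finite_set (sl_fin (chi u)) => r /=; apply: contraNP => /nzN ur.
  rewrite /F big1 ?eqxx// => i _; rewrite big1// => j _.
  by rewrite [E r i j u]ur -(scale0r (0 : V)) dotZl mul0r.
have F_ge0 u r : 0 <= F u u r.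
  apply: sumr_ge0 => i _; apply: sumr_ge0 => j _.
  have [->|/(@neq0_dnorm_gt0 _ _ _ ip0)/ltW//] := eqVneq (E r i j u) 0.
  by rewrite -(scale0r (0 : V)) dotZl mul0r.
have [|||ip ipE] := @dot_exists K V (fun u v => \sum_(r \in [set: I]) F u v r).
- move=> v a x y; rewrite mulr_fsumr -fsumD//.
    apply: eq_fsbigr => r _; rewrite /F mulr_sumr -big_split; apply: eq_bigr => i _ /=.
    rewrite mulr_sumr -big_split; apply: eq_bigr => j _ /=.
    by rewrite ED EZ dotDl dotZl.
  apply: sub_finite_set (F_fin x v) => r /=; apply: contra => /eqP ->.
  by rewrite mulr0.
- move=> u v; rewrite (fsum_morph (g := Num.conj)) ?rmorph0//; last exact: rmorphD.
  apply: eq_fsbigr => r _; rewrite /F rmorph_sum; apply: eq_bigr => i _ /=.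
  by rewrite rmorph_sum; apply: eq_bigr => j _; rewrite dotC.
(* A vanishing sum of nonnegative terms makes every [E r i j v] zero, and then [v] is zero by
   [E_inj]. *)
- move=> v v0; rewrite lt_def fsumr_ge0 ?andbT; last by move=> r _; apply: F_ge0.
  apply: contra v0 => /eqP F0; apply/eqP/E_inj => r i j.
  have Fr : F v v r = 0.
    apply/eqP; apply: contraT => Fr; move: F0.
    rewrite (fsum_fset_set (F_fin v v)) => [|s /negP]; last by rewrite negbK => /eqP.
    have rS : r \in (fset_set [set s | F v v s != 0] : seq I).
      by rewrite in_fset_set// inE.
    move/eqP; rewrite psumr_eq0 => [/allP/(_ r rS)|s _]; last exact: F_ge0.
    by rewrite /= (negPf Fr).
  have ip0_ge0 x : 0 <= ip0 x x.
    have [->|/(@neq0_dnorm_gt0 _ _ _ ip0)/ltW//] := eqVneq x 0.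
    by rewrite -(scale0r (0 : V)) dotZl mul0r.
  move/eqP: Fr; rewrite /F psumr_eq0 => [/allP/(_ i (mem_index_enum _))/=|k _]; last first.
    exact: sumr_ge0.
  rewrite psumr_eq0 => [/allP/(_ j (mem_index_enum _))/=|//] /eqP Eij.
  apply/eqP; apply: contraT => /(@neq0_dnorm_gt0 _ _ _ ip0).
  by rewrite Eij ltxx.
exists ip => u v.
(* The adjoint of [E r i j] is [E r j i]: both sides reduce to the sum over [k] of
   [ip0 (E r k j u) (E r k i v)]. *)
have ipEE r i j : ip (E r i j u) v = ip u (E r j i v).
  rewrite !ipE; transitivity (F (E r i j u) v r).
    apply: fsum_single => s sr; rewrite /F big1// => k _; rewrite big1// => l _.
    by rewrite E_mul0// -(scale0r (0 : V)) dotZl mul0r.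
  transitivity (F u (E r j i v) r); last first.
    apply/esym/fsum_single => s sr; rewrite /F big1// => k _; rewrite big1// => l _.
    by rewrite E_mul0// -(scale0r (0 : V)) dotZr rmorph0 mul0r.
  apply: eq_bigr => k _.
  transitivity (ip0 (E r k j u) (E r k i v)).
    rewrite (bigD1 i)//= E_mul eqxx scale1r big1 ?addr0// => l li.
    by rewrite E_mul (negPf li) dotZl mul0r.
  rewrite (bigD1 j)//= E_mul eqxx scale1r big1 ?addr0// => l lj.
  by rewrite E_mul (negPf lj) dotZr rmorph0 mul0r.
(* Unitarity is checked on coordinates: at [(i, j)] the two sides are [ip (E r i j u) v] and
   [ip u (E r j i v)], the swap of indices coming from [f_circ]. *)
apply/eqP; rewrite -subr_eq0; apply/eqP/f_inj => r; apply/matrixP => i j.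
rewrite fD -scaleN1r fZ mulN1r [RHS]mxE; apply/eqP; rewrite subr_eq0; apply/eqP.
rewrite (tsum_morph (g := fun c => f r c i j)); last exact: fD.
rewrite (tsum_morph (g := fun c => f r c i j)); last exact: fD.
transitivity (ip (E r i j u) v).
  rewrite /E /sl (tsum_morph (g := fun x => ip x v)); last first.
    by move=> x y; rewrite dotDl.
  by apply: eq_tsum => x c; rewrite fZ dotZl mulrC.
rewrite ipEE /E /sl (tsum_morph (g := ip u)); last by move=> x y; rewrite dotDr.
by apply: eq_tsum => x c; rewrite fZ f_circ dotZr mulrC.
Qed.

End Unitarization.

(** * From the decomposition to compactness, and the equivalence *)

Lemma compact_of_decomposition (K : numClosedFieldType) (C : circCoalgType K)
    (I : choiceType) (D : I -> set C) :
  is_direct_sum D ->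
  (forall r, exists (n : nat) (t : 'I_n -> 'I_n -> C),
     is_unitary_matrix_basis (D r) t) ->
  compact_coalgebra C.
Proof.
move=> [Dsub Duniq] Dbasis V chi chiP.
have D_lin r : lin_closed (D r) by apply/submod_closed_lin.
have decU c x y : decomposes D c x -> decomposes D c y -> x = y.
  by have [z [_ zU]] := Duniq c => /zU <- /zU <-.
have /choice[x xP] c : exists x, decomposes D c x.
  by have [z [zP _]] := Duniq c; exists z.
(* The type of the basis depends on its size, so the two are chosen together as a dependent pair. *)
have /choice[p pP] r : exists p : {n : nat & 'I_n -> 'I_n -> C},
    is_unitary_matrix_basis (D r) (projT2 p).
  by have [n [t tP]] := Dbasis r; exists (existT _ n t).
pose n r := projT1 (p r); pose t r : 'I_(n r) -> 'I_(n r) -> C := projT2 (p r).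
have tD r i j : D r (t r i j) by case: (pP r) => -[tD _] _; apply: tD.
(* [S r] rebuilds an element of [D r] from its coordinates. Its injectivity reduces the identities
   for [f] to identities between components. *)
pose S r (a : 'M[K]_(n r)) := \sum_i \sum_j a i j *: t r i j.
have S_lin r : linear (S r).
  move=> a b c; rewrite /S scaler_sumr -big_split; apply: eq_bigr => i _ /=.
  rewrite scaler_sumr -big_split; apply: eq_bigr => j _ /=.
  by rewrite !mxE scalerDl scalerA.
have S0 r : S r 0 = 0.
  by rewrite /S big1// => i _; rewrite big1// => j _; rewrite mxE scale0r.
have S_delta r i j : S r (delta_mx i j) = t r i j by exact: sum_delta_mx.
have S_D r a : D r (S r a).
  by apply: (@coef_span_min _ _ _ (t r)) => //; exists a.
have S_inj r : injective (S r).
  move=> a b ab; have [[_ tB] _] := pP r.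
  have [c [_ cU]] := tB (S r a) (S_D r a).
  by rewrite -(cU a erefl) -(cU b ab).
have fP r c : {a | x c r = S r a}.
  apply: cid; have [[_ tB] _] := pP r; have [xD _ _] := xP c.
  by have [a [aE _]] := tB (x c r) (xD r); exists a.
pose f r c := sval (fP r c).
have fE r c : S r (f r c) = x c r by rewrite -(svalP (fP r c)).
have x_t r s i j : x (t r i j) s = if s == r then t r i j else 0.
  by rewrite (decU _ _ _ (xP _) (decomposes_single D_lin (tD r i j))).
apply: (@unitarizable K C I n t f) => //.
- move=> r a c d; apply: S_inj; rewrite S_lin !fE.
  by rewrite (decU _ _ _ (xP _) (decomposes_lin D_lin a (xP c) (xP d))).
- move=> c; have [_ xfin _] := xP c.
  apply: sub_finite_set xfin => r /=; apply: contra => /eqP xr.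
  by apply/eqP/S_inj; rewrite fE xr S0.
- move=> c; have [_ _ {1}->] := xP c.
  by apply: eq_fsbigr => r _; rewrite -fE.
- by move=> r i j; apply: S_inj; rewrite fE x_t eqxx S_delta.
- move=> r s i j rs; apply: S_inj.
  by rewrite fE x_t eq_sym (negPf rs) S0.
- by move=> r i j; case: (pP r) => _ /(_ i j)[].
- by move=> r i j; case: (pP r) => _ /(_ i j)[].
Qed.

Theorem theorem4p3 (R : realType) (C : circCoalgType R[i]) :
  [<-> compact_coalgebra C;
       admits_unitary_inner_product (comul : {linear C -> (C ⊗ C)%type});
       exists w : {biscalar C},
         [/\ fourier_form w, posdef_form w & hermitian_form w];
       exists m : {bilinear C -> C -> C},
         [/\ fourier_product m, posdef_product m & hermitian_product m];
       exists (I : choiceType) (D : I -> set C),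
         is_direct_sum D
         /\ forall rho : I,
              is_simple_circ_subcoalgebra (D rho)
              /\ exists (n : nat) (t : 'I_n -> 'I_n -> C),
                   is_unitary_matrix_basis (D rho) t].
Proof.
tfae.
- by move=> compactC; apply: compactC; apply: comodule_comul.
- by move=> [ip uip]; apply: fourier_form_of_unitary uip.
- by move=> [w [wF wpos wH]]; apply: fourier_product_of_form wF wpos wH.
- move=> [m [mF mpos mH]].
  (* The product is first turned back into a unitary inner product, from which the decomposition is
     built. *)
  have [ip uip] := unitary_of_fourier_product mF mpos mH.
  have [I [D [Dsum Dirr]]] := irreducible_coef_space_decomposition uip.
  exists I, D; split=> // r; have [n [t [n_gt0 tU tirr ->]]] := Dirr r.
  split; first exact: (coef_span_simple uip tU tirr n_gt0).
  by exists n, t; apply: (coef_span_basis uip tU tirr).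
- move=> [I [D [Dsum Dbasis]]].
  apply: (compact_of_decomposition Dsum) => r.
  by have [_] := Dbasis r.
Qed.
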